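(* Let $\Omega\subset\mathbb{C}^n$ be a bounded domain. Suppose there exists a $\mathcal{C}^1$-smooth strictly increasing function $f:(0,+\infty)\to\mathbb{R}$ such that - $f(t)\to+\infty$ as $t\to+\infty$; and - for some $z_0\in\Omega$, we have $\mathsf{k}_\Omega(z_0,z)\leq f\Big(\dfrac{1}{\delta_\Omega(z)}\Big)$ for all $z\in\Omega$. Assume that $M_\Omega(t)\to0$ as $t\to0$ and that there exists an $r_0>0$ such that $$\int_0^{r_0}\frac{M_\Omega(r)}{r^2}\,f'\Big(\frac1r\Big)\,dr<\infty.$$ Then $\Omega$ is a visibility domain with respect to the Kobayashi distance.
   Context: Notation. $\|\cdot\|$ is the Euclidean norm and $\mathbb{D}\subset\mathbb{C}$ is the open unit disk. For a bounded domain $\Omega\subset\mathbb{C}^n$, $\delta_\Omega(z)$ is the Euclidean distance from $z\in\Omega$ to $\mathbb{C}^n\setminus\Omega$. The Kobayashi(--Royden) metric is $\kappa_\Omega(z;v)=\inf\{|\xi| : \xi\in\mathbb{C},\ \exists\,\varphi:\mathbb{D}\to\Omega \text{ holomorphic with } \varphi(0)=z,\ \varphi'(0)\xi=v\}$ for $z\in\Omega$, $v\in\mathbb{C}^n$. The Kobayashi distance is $\mathsf{k}_\Omega(z,w)=\inf_\gamma\int_0^1\kappa_\Omega(\gamma(t);\gamma'(t))\,dt$, the infimum being over piecewise $\mathcal{C}^1$ paths $\gamma:[0,1]\to\Omega$ from $z$ to $w$. Put $M_\Omega(r)=\sup\{1/\kappa_\Omega(z;v) : z\in\Omega,\ \delta_\Omega(z)\leq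 r,\ \|v\|=1\}$ for $r>0$. Almost-geodesics. For $\lambda\geq 1$, $\kappa\geq 0$ and an interval $I\subset\mathbb{R}$, a curve $\sigma:I\to\Omega$ is a $(\lambda,\kappa)$-almost-geodesic if (i) $\lambda^{-1}|t-s|-\kappa\leq \mathsf{k}_\Omega(\sigma(s),\sigma(t))\leq\lambda|t-s|+\kappa$ for all $s,t\in I$; and (ii) $\sigma$ is absolutely continuous and $\kappa_\Omega(\sigma(t);\sigma'(t))\leq\lambda$ for almost every $t\in I$. Visibility domain. A bounded domain $\Omega\subset\mathbb{C}^n$ is a visibility domain with respect to the Kobayashi distance if, given any $\lambda\geq1$ and $\kappa\geq0$, for each pair of distinct points $\xi,\eta\in\partial\Omega$ and each pair of $\overline\Omega$-open neighbourhoods $V$ of $\xi$ and $W$ of $\eta$ with $\overline V\cap\overline W=\varnothing$, there is a compact set $K\subset\Omega$ such that the image of each $(\lambda,\kappa)$-almost-geodesic $\sigma:[0,L]\to\Omega$ with $\sigma(0)\in V$, $\sigma(L)\in W$ intersects $K$. *)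

(* Defs.v *)
From HB Require Import structures.
From mathcomp Require Import all_boot all_order all_algebra.
From mathcomp Require Import complex.
From mathcomp Require Import all_classical all_reals all_analysis.

Set Implicit Arguments.
Unset Strict Implicit.
Unset Printing Implicit Defensive.

Import Order.TTheory GRing.Theory Num.Theory.
Import numFieldNormedType.Exports.

Local Open Scope classical_set_scope.
Local Open Scope ring_scope.
Local Open Scope complex_scope.

(* The library gives its standard topology and norm to an abstract field only,
   or to its copy [_^o]; this instance transfers them to the concrete [R[i]],
   as in [numFieldNormedType]. *)
#[non_forgetful_inheritance]
HB.instance Definition _ (R : realType) := NormedModule.copy R[i] R[i]^o.

Section ComplexSpace.
Context {R : realType} {n : nat}.
Implicit Types (z v w : 'rV[R[i]]_n) (Omega V : set 'rV[R[i]]_n).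

(* The library norm on ['rV[R[i]]_n] is the sup norm (with values in [R[i]]);
   it induces the same topology as the Euclidean norm below. *)
Definition enorm z : R :=
  Num.sqrt (\sum_(j < n) (complex.Re (z ord0 j) ^+ 2
                          + complex.Im (z ord0 j) ^+ 2)).

Definition bounded_domain Omega : Prop :=
  [/\ bounded_set Omega, open Omega, connected Omega & Omega !=set0].

Definition boundary_dist Omega z : R :=
  inf [set enorm (z - w) | w in ~` Omega].

Definition unit_disk : set R[i] := [set zeta | `|zeta| < 1].

(* Complex differentiability: [derivable] is over the field [R[i]] here. *)
Definition holomorphic_disk (phi : R[i] -> 'rV[R[i]]_n) : Prop :=
  forall zeta, unit_disk zeta -> derivable phi zeta 1.

Definition kobayashi_metric Omega z v : \bar R :=
  ereal_inf [set (complex.Re `|xi|)%:E | xi in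
    [set xi : R[i] | exists phi : R[i] -> 'rV[R[i]]_n,
      [/\ holomorphic_disk phi,
          forall zeta, unit_disk zeta -> Omega (phi zeta),
          phi 0 = z
        & xi *: derive1 phi 0 = v]]].

(* Curves are total functions on [R], used on an interval only. Their velocity
   is taken coordinatewise in the real and imaginary parts, because
   ['rV[R[i]]_n] is a normed module over [R[i]] and not over [R]. *)
Definition curve_derivable (g : R -> 'rV[R[i]]_n) (t : R) : Prop :=
  forall j, derivable (fun s => complex.Re (g s ord0 j)) t 1 /\
            derivable (fun s => complex.Im (g s ord0 j)) t 1.

Definition velocity (g : R -> 'rV[R[i]]_n) (t : R) : 'rV[R[i]]_n :=
  \row_j (derive1 (fun s => complex.Re (g s ord0 j)) t
          +i* derive1 (fun s => complex.Im (g s ord0 j)) t).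

(* Continuously differentiable up to the end points: [dg] is the continuous
   extension to [a, b] of the velocity on the open interval. *)
Definition C1_curve (a b : R) (g : R -> 'rV[R[i]]_n) : Prop :=
  {within `[a, b], continuous g} /\
  exists dg : R -> 'rV[R[i]]_n, {within `[a, b], continuous dg} /\
    forall t, a < t < b -> curve_derivable g t /\ velocity g t = dg t.

Definition piecewise_C1_curve (a b : R) (g : R -> 'rV[R[i]]_n) : Prop :=
  exists s : seq R, itv_partition a b s /\
    forall k, (k < size s)%N -> C1_curve (nth b (a :: s) k) (nth b s k) g.

Definition path_in Omega z w (g : R -> 'rV[R[i]]_n) : Prop :=
  [/\ piecewise_C1_curve 0 1 g,
      forall t, 0 <= t <= 1 -> Omega (g t),
      g 0 = z
    & g 1 = w].

Definition kobayashi_dist Omega z w : \bar R :=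
  ereal_inf
    [set (\int[lebesgue_measure]_(t in `[0%R, 1%R])
            kobayashi_metric Omega (g t) (velocity g t))%E
    | g in path_in Omega z w].

(* The function M_Omega; the inverse is the one of [\bar R]. *)
Definition kobayashi_M Omega (r : R) : \bar R :=
  ereal_sup [set y | exists z v,
    [/\ Omega z, boundary_dist Omega z <= r, enorm v = 1
      & y = ((kobayashi_metric Omega z v)^-1)%E]].

Definition absolutely_continuous_on (I : set R) (g : R -> 'rV[R[i]]_n) : Prop :=
  forall e : R, 0 < e -> exists2 d : R, 0 < d &
    forall (m : nat) (a b : 'I_m -> R),
      (forall i, a i <= b i /\ `[a i, b i] `<=` I) ->
      trivIset setT (fun i => `]a i, b i[%classic) ->
      \sum_(i < m) (b i - a i) < d ->
      \sum_(i < m) enorm (g (b i) - g (a i)) < e.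

Definition almost_geodesic Omega (lambda kappa : R) (I : interval R)
    (sigma : R -> 'rV[R[i]]_n) : Prop :=
  [/\ forall t, t \in I -> Omega (sigma t),
      forall s t, s \in I -> t \in I ->
        ((lambda^-1 * `|t - s| - kappa)%:E
           <= kobayashi_dist Omega (sigma s) (sigma t)
           <= (lambda * `|t - s| + kappa)%:E)%E,
      absolutely_continuous_on [set` I] sigma
    & {ae lebesgue_measure, forall t, t \in I -> curve_derivable sigma t /\
        (kobayashi_metric Omega (sigma t) (velocity sigma t) <= lambda%:E)%E}].

Definition boundary Omega : set 'rV[R[i]]_n := closure Omega `\` Omega°.

Definition closure_nbhs Omega z V : Prop :=
  V z /\ exists2 U, open U & V = U `&` closure Omega.

Definition visibility_domain Omega : Prop :=
  bounded_domain Omega /\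
  forall lambda kappa : R, 1 <= lambda -> 0 <= kappa ->
  forall xi eta, boundary Omega xi -> boundary Omega eta -> xi != eta ->
  forall V W, closure_nbhs Omega xi V -> closure_nbhs Omega eta W ->
    closure V `&` closure W = set0 ->
  exists K, [/\ compact K, K `<=` Omega &
    forall (L : R) (sigma : R -> 'rV[R[i]]_n), 0 <= L ->
      almost_geodesic Omega lambda kappa `[0, L] sigma ->
      V (sigma 0) -> W (sigma L) ->
      (sigma @` `[0, L]) `&` K !=set0].

End ComplexSpace.

(* Main.v *)
Require Import Defs.
From HB Require Import structures.
From mathcomp Require Import all_boot all_order all_algebra.
From mathcomp Require Import complex.
From mathcomp Require Import all_classical all_reals all_analysis.
From mathcomp Require Import measurable_realfun.
From mathcomp Require Import ring lra.

(* Along a (lambda, kappa)-almost-geodesic sigma, take t0 where the distance to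
   the boundary is largest. The triangle inequality through z0 gives
   |t - t0| / lambda - kappa <= f(1/delta(sigma t0)) + f(1/delta(sigma t))
                             <= 2 f(1/delta(sigma t)),
   so delta(sigma t) <= rho_k, where f(1/rho_k) = k0 + k, as soon as
   |t - t0| >= lambda (2 (k0 + k) + kappa), and the speed there is at most
   lambda M(rho_k). Since M is nondecreasing and r^-2 f'(1/r) has integral 1 over
   [rho_(k+1), rho_k], the series of the M(rho_k) converges: the far part of
   sigma is short, uniformly in sigma. The near part lasts a bounded time, and is
   short when sigma stays close to the boundary. Hence a curve joining V to W
   cannot stay close to the boundary. *)

Set Implicit Arguments.
Unset Strict Implicit.
Unset Printing Implicit Defensive.

Import Order.TTheory GRing.Theory Num.Theory.
Import numFieldNormedType.Exports.

Local Open Scope classical_set_scope.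
Local Open Scope ring_scope.
Local Open Scope complex_scope.

(** * Integration without measurability *)

(** The metric is an infimum over analytic disks and its measurability is not established here, so
    the length of a path is only a supremum over simple functions below its speed, with no
    additivity at hand. Cutting an integral and changing variables are therefore done on measurable
    functions below the speed. Nor is sigma recovered as the integral of its velocity: each real
    coordinate is absolutely continuous, and a covering argument turns an almost everywhere bound on
    its derivative into a Lipschitz bound on an interval. Accordingly M enters through the constants
    M(rho_k) on successive time intervals, not through an integral in time. A unit step of f costs
    time 2 lambda, because both terms of the triangle inequality are bounded by the same value of f.
    All thresholds are fixed before sigma, whose maximum point t0 then lets one estimate serve both
    time directions. *)

Section Integration.
Local Open Scope ereal_scope.
Context {R : realType}.
Implicit Types (D : set R) (f g : R -> \bar R).
Notation mu := (@lebesgue_measure R).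

(* The integral of a nonnegative function is a supremum over the simple functions
   below it, even when the function, like the speed of a path here, is not known
   to be measurable. *)
Lemma le_integral_nonmeasurable D E f g :
  D `<=` E -> (forall x, D x -> 0 <= f x) -> (forall x, E x -> 0 <= g x) ->
  (forall x, D x -> f x <= g x) ->
  \int[mu]_(x in D) f x <= \int[mu]_(x in E) g x.
Proof.
move=> DE f0 g0 fg; rewrite !ge0_integralE//.
apply: le_ereal_sup => _ [h hf <-]; exists h => // x.
apply: le_trans (hf x) _; rewrite !patchE.
case: ifPn => [/set_mem Dx|_]; first by rewrite mem_set ?fg//; exact: DE.
by case: ifPn => // /set_mem/g0.
Qed.

Import HBNNSimple.

(** The way around the missing measurability of [f]: the minorants [h] are measurable, so their
    integrals can be cut and transformed by a change of variables before being bounded by [c]. *)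
Lemma integral_le_measurable_minorants D f c : measurable D ->
  (forall x, D x -> 0 <= f x) ->
  (forall h : R -> R, measurable_fun [set: R] h -> (forall x, (0 <= h x)%R) ->
    (forall x, D x -> (h x)%:E <= f x) ->
    \int[mu]_(x in D) (h x)%:E <= c) ->
  \int[mu]_(x in D) f x <= c.
Proof.
move=> mD f0 hc; rewrite ge0_integralE//; apply: ge_ereal_sup => _ [h hf <-].
have hfD x : D x -> (h x)%:E <= f x.
  by move=> Dx; apply: le_trans (hf x) _; rewrite patchE mem_set.
have h0 x : (0 <= h x)%R by exact: fun_ge0.
have := hc h (measurable_funPT h) h0 hfD.
(* Off [D] the simple function is both nonnegative and at most 0, so restricting it to [D] does not
   change it. *)
rewrite integral_nnsfun// (_ : h \_ D = h)//.
apply/funext => x; rewrite patchE; case: ifPn => // xD.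
have := hf x; rewrite patchE (negbTE xD) lee_fin => hx0.
by apply/eqP; rewrite eq_le hx0 fun_ge0.
Qed.


Lemma measurable_affine (a b : R) :
  measurable_fun [set: R] (fun x => a * x + b : R)%R.
Proof.
by apply: measurable_funD.
Qed.

(** By uniqueness of Lebesgue measure: the right-hand side is a measure in [A], and it gives
    half-open intervals their length. For [a < 0] the preimage exchanges the open and the closed
    end, hence the two cases. *)
Lemma lebesgue_measure_affine (a b : R) (A : set R) : a != 0%R ->
  measurable A ->
  mu A = `|a|%:E * mu ((fun x => a * x + b)%R @^-1` A).
Proof.
move=> a0 mA.
pose g := (fun x : measurableTypeR R => a * x + b : measurableTypeR R)%R.
have mg : measurable_fun setT g by exact: measurable_affine.
pose nu : {measure set (measurableTypeR R) -> \bar R} :=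
  measure_function_pushforward__canonical__measure_function_Measure mu mg.
pose k : {nonneg R} := NngNum (normr_ge0 a).
apply: (@lebesgue_measure_unique R (mscale k nu)) => //.
move=> _ [[u v]] _ <-; rewrite lebesgue_measure_itv/=.
change (mscale _ _ _) with (`|a|%:E * mu (g @^-1` `]u, v]%classic)).
have [a_lt0|a_gt0|] := ltgtP a 0%R; last by move/eqP; rewrite (negbTE a0).
- rewrite [X in _%:E * mu X](_ : _ = `[(v - b) / a, (u - b) / a[%classic)%R; last first.
    apply/seteqP; split => x /=; rewrite /g !in_itv/= => /andP[h1 h2].
      by rewrite ler_ndivrMr// ltr_ndivlMr//; apply/andP; split; lra.
    by move: h1 h2; rewrite ler_ndivrMr// ltr_ndivlMr// => h1 h2; apply/andP; split; lra.
  rewrite lebesgue_measure_itv/= !lte_fin ltr_nM2r ?invr_lt0// ltrD2r.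
  case: ifPn => uv; last by rewrite mule0.
  by rewrite -!EFinB -EFinM ltr0_norm//; congr (_%:E); field.
- rewrite [X in _%:E * mu X](_ : _ = `](u - b) / a, (v - b) / a]%classic)%R; last first.
    apply/seteqP; split => x /=; rewrite /g !in_itv/= => /andP[h1 h2].
      by rewrite ltr_pdivrMr// ler_pdivlMr//; apply/andP; split; lra.
    by move: h1 h2; rewrite ltr_pdivrMr// ler_pdivlMr// => h1 h2; apply/andP; split; lra.
  rewrite lebesgue_measure_itv/= !lte_fin ltr_pM2r ?invr_gt0// ltrD2r.
  case: ifPn => uv; last by rewrite mule0.
  by rewrite -!EFinB -EFinM gtr0_norm//; congr (_%:E); field.
Qed.

Lemma ge0_integral_affine (a b : R) D (f : R -> \bar R) : a != 0%R ->
  measurable D -> measurable_fun D f -> (forall x, D x -> 0 <= f x) ->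
  \int[mu]_(x in D) f x =
  `|a|%:E * \int[mu]_(x in (fun x => a * x + b)%R @^-1` D) f (a * x + b)%R.
Proof.
move=> a0 mD mf f0.
pose g := (fun x : measurableTypeR R => a * x + b : measurableTypeR R)%R.
have mg : measurable_fun setT g by exact: measurable_affine.
pose k : {nonneg R} := NngNum (normr_ge0 a).
pose nu : {measure set (measurableTypeR R) -> \bar R} :=
  measure_function_pushforward__canonical__measure_function_Measure mu mg.
transitivity (\int[mscale k nu]_(x in D) f x).
  by apply: eq_measure_integral => A mA _; exact: lebesgue_measure_affine.
rewrite ge0_integral_mscale//= (ge0_integral_pushforward mg)//.
by move=> x /set_mem; exact: f0.
Qed.
End Integration.

(** * The Kobayashi metric and affine reparametrization *)

Section Metric.
Context {R : realType} {n : nat}.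
Implicit Types (Omega : set 'rV[R[i]]_n) (z v w : 'rV[R[i]]_n).

Lemma Re_normcM (a b : R[i]) :
  complex.Re `|a * b| = complex.Re `|a| * complex.Re `|b|.
Proof. by rewrite normrM !normc_def /= mulr0 subr0. Qed.

Lemma Re_normc_real (c : R) : complex.Re `|c%:C| = `|c|.
Proof. by rewrite normc_def /= expr0n addr0 sqrtr_sqr. Qed.

Lemma Re_normc_ge0 (a : R[i]) : 0 <= complex.Re `|a|.
Proof. by rewrite normc_def /= sqrtr_ge0. Qed.

Lemma kobayashi_metric_ge0 Omega z v : (0 <= kobayashi_metric Omega z v)%E.
Proof.
by apply: le_ereal_inf_tmp => _ [xi _ <-]; rewrite lee_fin Re_normc_ge0.
Qed.

(** A disk that competes for [v] with the scalar [xi] competes for [c v] with [c xi]. *)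
Lemma kobayashi_metricZ_le Omega z v (c : R) : c != 0 ->
  (kobayashi_metric Omega z (c%:C *: v) <= `|c|%:E * kobayashi_metric Omega z v)%E.
Proof.
move=> c0; rewrite -lee_pdivrMl ?normr_gt0//.
apply: le_ereal_inf_tmp => _ [xi [phi [hphi phiO phi0 phiv]] <-].
rewrite lee_pdivrMl ?normr_gt0// -EFinM -Re_normc_real -Re_normcM.
apply: ereal_inf_lbound; exists (c%:C * xi) => //.
by exists phi; split => //; rewrite -phiv scalerA.
Qed.

Lemma is_derive_affine (c d t : R) :
  is_derive t (1 : R) (fun x => c * x + d) c.
Proof.
have h1 : is_derive t (1 : R) (fun x : R => c * x) c.
  have := @is_deriveZ R R R (@id R) c t 1 1 (is_derive_id t (1 : R)).
  by rewrite -[X in is_derive _ _ _ X]/(c * 1) mulr1.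
have h2 : is_derive t (1 : R) (fun=> d) (0 : R) by exact: is_derive_cst.
have := @is_deriveD R R R _ _ t 1 _ _ h1 h2.
by rewrite addr0.
Qed.

Lemma derivable_affine (f : R -> R) (c d t : R) :
  derivable f (c * t + d) 1 -> derivable (fun x => f (c * x + d)) t 1.
Proof.
move=> df.
have : is_derive (c * t + d) (1:R) f (derive f (c * t + d) 1) by exact: derivableP.
have hc := is_derive_affine c d t.
move=> hf; have := @is_derive1_comp _ f (fun x => c * x + d) t _ _ hf hc.
by case.
Qed.

(** True at every point, derivable or not: the inverse affine map carries derivability back to [f],
    and where it fails both derivatives have the default value 0. The speed of a path is thus
    transformed at every time, with no exceptional set. *)
Lemma derive1_affine (f : R -> R) (c d t : R) : c != 0 ->
  derive1 (fun x => f (c * x + d)) t = c * derive1 f (c * t + d).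
Proof.
move=> c0; rewrite !derive1E.
have [df|ndf] := pselect (derivable f (c * t + d) 1).
  have hf : is_derive (c * t + d) (1:R) f (derive f (c * t + d) 1) by exact: derivableP.
  have hc := is_derive_affine c d t.
  have [_ ->] := @is_derive1_comp _ f (fun x => c * x + d) t _ _ hf hc.
  by rewrite mulrC.
have ndg : ~ derivable (fun x => f (c * x + d)) t 1.
  move=> dg; apply: ndf.
  have te : c^-1 * (c * t + d) + (- c^-1 * d) = t by field.
  have fE : (fun x => f (c * (c^-1 * x + (- c^-1 * d)) + d)) = f.
    by apply/funext => x; congr (f _); field.
  rewrite -te in dg.
  have := derivable_affine dg.
  by rewrite fE.
by rewrite /derive (dvgP ndf) (dvgP ndg) -[point]/(0:R) mulr0.
Qed.

Lemma velocity_affine (g : R -> 'rV[R[i]]_n) (c d t : R) : c != 0 ->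
  velocity (fun x => g (c * x + d)) t = c%:C *: velocity g (c * t + d).
Proof.
move=> c0; apply/rowP => j; rewrite !mxE.
rewrite (derive1_affine (fun s => complex.Re (g s ord0 j)))//.
rewrite (derive1_affine (fun s => complex.Im (g s ord0 j)))//.
by apply/eqP; rewrite eq_complex /= !mul0r subr0 addr0 !eqxx.
Qed.

Lemma near_eq_velocity (g1 g2 : R -> 'rV[R[i]]_n) t :
  (\forall s \near t, g1 s = g2 s) -> velocity g1 t = velocity g2 t.
Proof.
move=> g12; apply/rowP => j; rewrite !mxE !derive1E.
by congr (_ +i* _); apply: near_eq_derive; apply: filterS g12 => s ->.
Qed.

Lemma near_eq_curve_derivable (g1 g2 : R -> 'rV[R[i]]_n) t :
  (\forall s \near t, g1 s = g2 s) -> curve_derivable g1 t -> curve_derivable g2 t.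
Proof.
move=> g12 dg j; have [dre dim] := dg j.
by split; [apply: near_eq_derivable dre|apply: near_eq_derivable dim];
   apply: filterS g12 => s ->.
Qed.

Lemma curve_derivable_affine (g : R -> 'rV[R[i]]_n) (c d t : R) :
  curve_derivable g (c * t + d) -> curve_derivable (fun x => g (c * x + d)) t.
Proof.
move=> dg j; have [dre dim] := dg j; split.
  exact: (@derivable_affine (fun s => complex.Re (g s ord0 j))).
exact: (@derivable_affine (fun s => complex.Im (g s ord0 j))).
Qed.
End Metric.

(** * Piecewise C^1 paths: concatenation and affine change of parameter *)

Section Paths.
Context {R : realType} {n : nat}.
Implicit Types (g : R -> 'rV[R[i]]_n).

Lemma within_continuous_comp (T U V : topologicalType) (A : set T) (B : set U)
  (phi : T -> U) (g : U -> V) : continuous phi -> (forall x, A x -> B (phi x)) ->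
  {within B, continuous g} -> {within A, continuous (g \o phi)}.
Proof.
move=> cphi AB /subspace_continuousP cg; apply/subspace_continuousP => x Ax.
have h : phi @ within A (nbhs x) --> within B (nbhs (phi x)).
  move=> N hN; change (nbhs x (fun y => A y -> N (phi y))).
  have h : nbhs x (fun y => B (phi y) -> N (phi y)) := cphi x _ hN.
  by apply: filterS h => y hy /AB; exact: hy.
exact: cvg_comp h (cg _ (AB _ Ax)).
Qed.

Lemma continuous_affine (c d : R) : continuous (fun x : R => c * x + d).
Proof.
move=> x; have [dx _] := is_derive_affine c d x.
exact/differentiable_continuous/derivable1_diffP.
Qed.

(** The intervals are related by inclusions and not by formulas for their end points, so that one
    statement covers both orientations, [c > 0] and [c < 0]. *)
Lemma C1_curve_affine (a b a' b' c d : R) g : c != 0 ->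
  (forall x, a' <= x <= b' -> a <= c * x + d <= b) ->
  (forall x, a' < x < b' -> a < c * x + d < b) ->
  C1_curve a b g -> C1_curve a' b' (fun x => g (c * x + d)).
Proof.
move=> c0 hcc hoo [cg [dg [cdg hdg]]].
have hA x : `[a', b']%classic x -> `[a, b]%classic (c * x + d).
  by rewrite /= !in_itv/=; exact: hcc.
split.
  exact: (within_continuous_comp (@continuous_affine c d) hA cg).
exists (fun x => c%:C *: dg (c * x + d)); split.
  have := within_continuous_comp (@continuous_affine c d) hA cdg.
  move=> /subspace_continuousP h; apply/subspace_continuousP => x Ax.
  by apply: cvgZr; exact: h.
move=> t /hoo /hdg[h1 h2]; split; first exact: curve_derivable_affine.
by rewrite velocity_affine// h2.
Qed.

Lemma C1_curve_eq (a b : R) g1 g2 : (forall x, a <= x <= b -> g1 x = g2 x) ->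
  C1_curve a b g1 -> C1_curve a b g2.
Proof.
move=> g12 [cg [dg [cdg hdg]]]; split.
  apply: subspace_eq_continuous cg => x /set_mem/=; rewrite in_itv/=.
  exact: g12.
exists dg; split => // t tab.
have near12 : \forall s \near t, g1 s = g2 s.
  have tin : t \in `]a, b[ by rewrite in_itv.
  apply: filterS (near_in_itvoo tin) => s; rewrite in_itv/= => /andP[sa sb].
  by apply: g12; rewrite !ltW.
have [h1 h2] := hdg t tab; split; first exact: near_eq_curve_derivable h1.
by rewrite -(near_eq_velocity near12).
Qed.

Lemma piecewise_C1_curve_cons (a c b : R) g : a < c -> C1_curve a c g ->
  piecewise_C1_curve c b g -> piecewise_C1_curve a b g.
Proof.
move=> ac cg [s [[ps /eqP ls] cs]]; exists (c :: s); split.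
  by split; rewrite /= ?ac ?ls.
case=> [|k]//= ks; exact: cs.
Qed.

(** Peels off the first C^1 piece while the right end stays fixed, so that later proofs never handle
    the list of break points. *)
Lemma piecewise_C1_curve_ind (b : R) g (P : R -> Prop) :
  P b ->
  (forall a c, a < c -> C1_curve a c g -> piecewise_C1_curve c b g -> P c -> P a) ->
  forall a, piecewise_C1_curve a b g -> P a.
Proof.
move=> Pb Pcons a [s]; elim: s a => [|c s IHs] a [[/= ps ls] cs].
  by rewrite (eqP ls).
have /andP[ac ps'] := ps.
have hs : itv_partition c b s by split.
have cs' k : (k < size s)%N -> C1_curve (nth b (c :: s) k) (nth b s k) g.
  by move=> ks; exact: (cs k.+1).
apply: (Pcons a c) => //; first exact: (cs 0%N).
  by exists s.
exact: IHs.
Qed.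

Lemma piecewise_C1_curve_refl (a : R) g : piecewise_C1_curve a a g.
Proof. by exists [::]; split => //; split. Qed.

Lemma piecewise_C1_curve_le (a b : R) g : piecewise_C1_curve a b g -> a <= b.
Proof. by case=> s [/itv_partition_le]. Qed.

Lemma piecewise_C1_curve_trans (a c b : R) g : piecewise_C1_curve a c g ->
  piecewise_C1_curve c b g -> piecewise_C1_curve a b g.
Proof.
move=> ac cb; move: a ac; apply: piecewise_C1_curve_ind => // a e ae cae _.
exact: piecewise_C1_curve_cons.
Qed.

Lemma piecewise_C1_curve1 (a b : R) g : a < b -> C1_curve a b g ->
  piecewise_C1_curve a b g.
Proof.
move=> ab cab; apply: piecewise_C1_curve_cons ab cab _.
exact: piecewise_C1_curve_refl.
Qed.

Lemma piecewise_C1_curve_eq (a b : R) g1 g2 :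
  (forall x, a <= x <= b -> g1 x = g2 x) ->
  piecewise_C1_curve a b g1 -> piecewise_C1_curve a b g2.
Proof.
move=> + pab; move: a pab; apply: piecewise_C1_curve_ind.
  by move=> _; exact: piecewise_C1_curve_refl.
move=> a c ac cac pcb IH g12.
have cb := piecewise_C1_curve_le pcb.
apply: (piecewise_C1_curve_cons ac).
  apply: C1_curve_eq cac => x /andP[ax xc].
  by rewrite g12// ax (le_trans xc).
by apply: IH => x /andP[cx xb]; rewrite g12// xb (le_trans (ltW ac)).
Qed.

Lemma piecewise_C1_curve_incr (a b c d : R) g : 0 < c ->
  piecewise_C1_curve (c * a + d) (c * b + d) g ->
  piecewise_C1_curve a b (fun x => g (c * x + d)).
Proof.
(* The induction runs over the pieces of [g], so the moving end point is expressed in the parameter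
   [u] of [g]. *)
move=> c0; have [u ->] : exists u, a = (u - d) / c.
  by exists (c * a + d); field; rewrite gt_eqF.
rewrite (_ : c * ((u - d) / c) + d = u); last by field; rewrite gt_eqF.
move: u; apply: piecewise_C1_curve_ind.
  rewrite (_ : (_ - d) / c = b); last by field; rewrite gt_eqF.
  exact: piecewise_C1_curve_refl.
move=> u v uv cuv _; apply: piecewise_C1_curve_cons.
  by rewrite ltr_pM2r ?invr_gt0// ltrD2r.
apply: C1_curve_affine cuv; first by rewrite gt_eqF.
  by move=> x; rewrite ler_pdivrMr// ler_pdivlMr//; lra.
by move=> x; rewrite ltr_pdivrMr// ltr_pdivlMr//; lra.
Qed.

Lemma piecewise_C1_curve_decr (a b c d : R) g : c < 0 ->
  piecewise_C1_curve (c * b + d) (c * a + d) g ->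
  piecewise_C1_curve a b (fun x => g (c * x + d)).
Proof.
move=> c0; have [u ->] : exists u, b = (u - d) / c.
  by exists (c * b + d); field; rewrite lt_eqF.
rewrite (_ : c * ((u - d) / c) + d = u); last by field; rewrite lt_eqF.
move: u; apply: piecewise_C1_curve_ind.
  rewrite (_ : (_ - d) / c = a); last by field; rewrite lt_eqF.
  exact: piecewise_C1_curve_refl.
(* Time is reversed: the first piece of [g] becomes the last piece of the new path and is appended
   on the right. *)
move=> u v uv cuv _ IH; apply: piecewise_C1_curve_trans IH _.
apply: piecewise_C1_curve1.
  by rewrite ltr_nM2r ?invr_lt0// ltrD2r.
apply: C1_curve_affine cuv; first by rewrite lt_eqF.
  by move=> x; rewrite ler_ndivrMr// ler_ndivlMr//; lra.
by move=> x; rewrite ltr_ndivrMr// ltr_ndivlMr//; lra.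
Qed.
End Paths.

(** * The triangle inequality for the Kobayashi distance *)

Section Triangle.
Context {R : realType} {n : nat}.
Implicit Types (g : R -> 'rV[R[i]]_n) (Omega : set 'rV[R[i]]_n).
Notation mu := (@lebesgue_measure R).
Notation speed Omega g := (fun t : R => kobayashi_metric Omega (g t) (velocity g t)).

(** Handles one half of a concatenated path [g]. Since [h] is measurable, the change of variable
    applies to it; its factor [|c^-1|] cancels the factor [|c|] by which the speed of [g1] is
    scaled. The interval is open because [g] and the reparametrized [g1] have the same velocity only
    where they agree nearby. *)
Lemma integral_le_speed_affine Omega g g1 (c d u v : R) (h : R -> R) : c != 0 ->
  (forall t, u < t < v -> 0 <= c * t + d <= 1) ->
  (forall t, u < t < v -> g t = g1 (c * t + d)) ->
  measurable_fun [set: R] h -> (forall t, 0 <= h t) ->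
  (forall t, u < t < v -> ((h t)%:E <= speed Omega g t)%E) ->
  (\int[mu]_(t in `]u, v[) (h t)%:E <= \int[mu]_(t in `[0%R, 1%R]) speed Omega g1 t)%E.
Proof.
move=> c0 maps gg1 mh h0 hle.
have ci0 : c^-1 != 0 by rewrite invr_eq0.
rewrite (@ge0_integral_affine _ c^-1 (- (c^-1 * d)))//; last 2 first.
- by apply/measurable_EFinP; exact: measurable_funTS.
- by move=> x _; rewrite lee_fin.
set D := _ @^-1` _.
have De s : D s -> u < c^-1 * s - c^-1 * d < v.
  by rewrite /D /= in_itv.
have ce s : c * (c^-1 * s - c^-1 * d) + d = s by field.
have mD : measurable D.
  by rewrite -[D]setTI; apply: measurable_affine => //; exact: measurable_itv.
rewrite -ge0_integralZl//; last 2 first.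
- apply/measurable_EFinP; apply: measurable_funTS; apply: measurableT_comp => //.
  exact: measurable_affine.
- by move=> x _; rewrite lee_fin.
apply: le_integral_nonmeasurable.
- by move=> s /De /maps; rewrite ce /= in_itv.
- by move=> s _; rewrite mule_ge0// lee_fin.
- by move=> s _; exact: kobayashi_metric_ge0.
move=> s /De suv.
have [t [tE sE]] : exists t, c^-1 * s - c^-1 * d = t /\ s = c * t + d.
  by exists (c^-1 * s - c^-1 * d).
rewrite tE in suv; rewrite tE sE.
have gt : \forall r \near t, g r = g1 (c * r + d).
  have tin : t \in `]u, v[ by rewrite in_itv.
  by apply: filterS (near_in_itvoo tin) => r; rewrite in_itv/=; exact: gg1.
have gE : g t = g1 (c * t + d) by exact: gg1.
have velE : velocity g t = c%:C *: velocity g1 (c * t + d).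
  by rewrite -velocity_affine//; exact: near_eq_velocity.
have := hle t suv; rewrite gE velE => ht.
have hc : ((h t)%:E <= `|c|%:E * speed Omega g1 (c * t + d)%R)%E.
  by apply: le_trans ht _; exact: kobayashi_metricZ_le.
by rewrite normrV ?unitfE// lee_pdivrMl ?normr_gt0.
Qed.

(** The first path is run backwards, so that both bounds in the triangle inequality are distances
    from [z0], the form in which the growth hypothesis supplies them. *)
Lemma path_in_through Omega z0 z w g1 g2 :
  path_in Omega z0 z g1 -> path_in Omega z0 w g2 ->
  path_in Omega z w (fun t => if t <= 2^-1 then g1 (-2 * t + 1) else g2 (2 * t + (- 1))).
Proof.
have e1 : -2 * 2^-1 + 1 = 0 :> R by field.
have e2 : -2 * 0 + 1 = 1 :> R by ring.
have e3 : 2 * 2^-1 + (- 1) = 0 :> R by field.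
have e4 : 2 * 1 + (- 1) = 1 :> R by ring.
have half0 : 0 <= 2^-1 :> R by rewrite invr_ge0.
have half1 : 2^-1 < 1 :> R by rewrite invf_lt1// ltr1n.
move=> [p1 O1 g10 g11] [p2 O2 g20 g21]; split.
- apply: (@piecewise_C1_curve_trans _ _ _ 2^-1).
    apply: (@piecewise_C1_curve_eq _ _ _ _ (fun t => g1 (-2 * t + 1))).
      by move=> x /andP[_ ->].
    apply: piecewise_C1_curve_decr; first by lra.
    by rewrite e1 e2.
  apply: (@piecewise_C1_curve_eq _ _ _ _ (fun t => g2 (2 * t + (- 1)))).
    move=> x /andP[x1 x2]; case: ifPn => // x3.
    have -> : x = 2^-1 by apply/eqP; rewrite eq_le x3 x1.
    by rewrite e1 e3 g10.
  apply: piecewise_C1_curve_incr; first by [].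
  by rewrite e3 e4.
- move=> t /andP[t0 t1]; case: ifPn => t2; first by apply: O1; lra.
  by apply: O2; move: t2; rewrite -ltNge => t2; lra.
- by rewrite half0 e2.
- by rewrite leNgt half1 /= e4.
Qed.

Lemma kobayashi_dist_ge0 Omega z w : (0 <= kobayashi_dist Omega z w)%E.
Proof.
apply: le_ereal_inf_tmp => _ [g _ <-]; apply: integral_ge0 => t _.
exact: kobayashi_metric_ge0.
Qed.

(** Two paths that are minimal up to [e / 2] are joined. The length of the joined path is bounded
    through its measurable minorants, whose integrals can be cut at 1/2. *)
Lemma kobayashi_dist_triangle Omega z0 z w :
  (kobayashi_dist Omega z w <= kobayashi_dist Omega z0 z + kobayashi_dist Omega z0 w)%E.
Proof.
have [->|k1] := eqVneq (kobayashi_dist Omega z0 z) +oo%E.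
  rewrite addye ?leey// gt_eqF// (lt_le_trans _ (kobayashi_dist_ge0 _ _ _))//.
have [->|k2] := eqVneq (kobayashi_dist Omega z0 w) +oo%E.
  rewrite addey ?leey// gt_eqF// (lt_le_trans _ (kobayashi_dist_ge0 _ _ _))//.
have f1 : kobayashi_dist Omega z0 z \is a fin_num.
  by rewrite ge0_fin_numE ?kobayashi_dist_ge0// ltey.
have f2 : kobayashi_dist Omega z0 w \is a fin_num.
  by rewrite ge0_fin_numE ?kobayashi_dist_ge0// ltey.
apply/lee_addgt0Pr => e e0; have e20 : 0 < e / 2 by rewrite divr_gt0.
have [_ [g1 p1 <-] lt1] := lb_ereal_inf_adherent e20 f1.
have [_ [g2 p2 <-] lt2] := lb_ereal_inf_adherent e20 f2.
have pg := path_in_through p1 p2.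
set g := (fun t => _) in pg.
apply: le_trans.
  by apply: ereal_inf_lbound; exists g.
rewrite [e]splitr EFinD addeACA.
apply: le_trans (leeD (ltW lt1) (ltW lt2)).
apply: integral_le_measurable_minorants => //.
  by move=> t _; exact: kobayashi_metric_ge0.
move=> h mh h0 hle.
have mhE D : measurable_fun D (fun t => (h t)%:E).
  by apply/measurable_EFinP; exact: measurable_funTS.
have half0 : 0 <= 2^-1 :> R by rewrite invr_ge0.
have half1 : 2^-1 <= 1 :> R by rewrite invf_le1// ler1n.
have -> : (\int[mu]_(x in `[0%R, 1%R]) (h x)%:E =
    \int[mu]_(x in `[0%R, 2^-1%R]) (h x)%:E + \int[mu]_(x in `]2^-1%R, 1%R]) (h x)%:E)%E.
  have -> : `[0, 1]%classic = `[0, 2^-1]%classic `|` `]2^-1, 1]%classic :> set R.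
    by apply: itv_bndbnd_setU; rewrite bnd_simp.
  rewrite ge0_integral_setU//=.
  - exact: mhE.
  - by move=> x _; rewrite lee_fin.
  - apply/disj_setPS => x /= []; rewrite !in_itv/= => /andP[_ h1] /andP[h2 _].
    by move: h2; rewrite ltNge h1.
(* The velocity at the junction depends on both paths; the end points are null and are dropped
   before the comparison. *)
rewrite integral_itv_bndoo; last exact: mhE.
rewrite [X in (_ + X <= _)%E]integral_itv_bndoo; last exact: mhE.
apply: leeD.
- apply: (integral_le_speed_affine (g := g) (c := -2) (d := 1)) => //.
  + by move=> t /andP[t0 t1]; apply/andP; split; lra.
  + by move=> t /andP[t0 t1]; rewrite /g (ltW t1).
  + move=> t /andP[t0 t1]; apply: hle; rewrite /= in_itv/=.
    by rewrite (ltW t0) (le_trans (ltW t1)).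
- apply: (integral_le_speed_affine (g := g) (c := 2) (d := - 1)) => //.
  + by move=> t /andP[t0 t1]; apply/andP; split; lra.
  + by move=> t /andP[t0 t1]; rewrite /g leNgt t0.
  + move=> t /andP[t0 t1]; apply: hle; rewrite /= in_itv/=.
    by rewrite (ltW t1) (le_trans half0 (ltW t0)).
Qed.
End Triangle.

(** * Absolutely continuous functions *)

Section AbsoluteContinuity.
Context {R : realType}.
Implicit Types (h : R -> R) (A B C e t : R).
Notation mu := (@lebesgue_measure R).

Lemma derivable_local_bound h t C e : 0 < e -> derivable h t 1 ->
  `|derive1 h t| <= C ->
  exists2 d : R, 0 < d & forall x, `|x - t| < d -> `|h x - h t| <= (C + e) * `|x - t|.
Proof.
move=> e0 dh hC; rewrite derive1E in hC.
have /cvgrPdist_lt/(_ e e0) := dh.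
rewrite near_withinE => /nbhs_ballP[d /= d0 hd]; exists d => // x xd.
have [->|xt] := eqVneq x t; first by rewrite !subrr normr0 mulr0.
have xt0 : x - t != 0 by rewrite subr_eq0.
have := hd (x - t); rewrite /ball/= sub0r normrN => /(_ xd xt0).
rewrite [(x - t) *: 1]mulr1 subrK => hlt.
have -> : h x - h t =
    - ('D_1 h t - (x - t)^-1 *: (h x - h t)) * (x - t) + 'D_1 h t * (x - t).
  by rewrite -[_ *: _]/(_ * _); field.
apply: le_trans (ler_normD _ _) _; rewrite !normrM -mulrDl ler_wpM2r//.
rewrite normrN addrC; apply: lerD => //; exact: ltW.
Qed.

(** An ordered list, because the argument below only ever adds an interval at the right end.
    Neighbours may share an end point, so only the open intervals are disjoint, which is what
    absolute continuity asks for. *)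
Let chain (U : set R) A x (s : seq (R * R)) :=
  [/\ forall p, p \in s -> [/\ A <= p.1, p.1 <= p.2, p.2 <= x & `[p.1, p.2] `<=` U]
    & pairwise (fun p q : R * R => p.2 <= q.1) s].

Lemma sum_chain_lt (U : set R) A B (s : seq (R * R)) (d : R) : open U ->
  (mu U < d%:E)%E -> chain U A B s ->
  \sum_(i < size s) ((nth (0%R, 0%R) s i).2 - (nth (0%R, 0%R) s i).1) < d /\
  trivIset setT (fun i : 'I_(size s) =>
    `](nth (0%R, 0%R) s i).1, (nth (0%R, 0%R) s i).2[%classic).
Proof.
move=> oU Ud [cs ps].
have tI : trivIset setT (fun i : 'I_(size s) =>
    `](nth (0%R, 0%R) s i).1, (nth (0%R, 0%R) s i).2[%classic).
  apply/trivIsetP => i j _ _ ij.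
  wlog lij : i j ij / (i < j)%N.
    move=> W; have [|] := ltnP i j; first exact: W.
    rewrite leq_eqVlt => /orP[/eqP/val_inj ji|ji]; first by rewrite ji eqxx in ij.
    by rewrite setIC; apply: W => //; rewrite eq_sym.
  rewrite -subset0 => x /= []; rewrite !in_itv/= => /andP[_ x1] /andP[x2 _].
  have /(pairwiseP (0%R, 0%R)) h := ps.
  have := h i j; rewrite !inE => /(_ (ltn_ord i) (ltn_ord j) lij).
  by rewrite leNgt (lt_trans x2 x1).
split => //; rewrite -lte_fin; apply: le_lt_trans Ud.
have -> : ((\sum_(i < size s) ((nth (0%R, 0%R) s i).2 - (nth (0%R, 0%R) s i).1))%:E =
    \sum_(i < size s) mu `](nth (0%R, 0%R) s i).1, (nth (0%R, 0%R) s i).2[%classic)%E.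
  rewrite -sumEFin; apply: eq_bigr => i _.
  have [_ le12 _ _] := cs _ (mem_nth (0%R, 0%R) (ltn_ord i)).
  rewrite lebesgue_measure_itv/= lte_fin.
  by move: le12; rewrite le_eqVlt => /orP[/eqP->|->//]; rewrite ltxx subrr.
rewrite -measure_bigsetU_ord//; apply: le_measure.
- rewrite inE; apply: bigsetU_measurable => i _; exact: measurable_itv.
- by rewrite inE; exact: open_measurable.
elim/big_ind: _ => //; first by move=> X Y XU YU x [/XU|/YU].
move=> i _ x /=; rewrite in_itv/= => /andP[x1 x2].
have [_ _ _] := cs _ (mem_nth (0%R, 0%R) (ltn_ord i)); apply.
by rewrite /= in_itv/= !ltW.
Qed.

(** At a good point the derivative controls [h] locally. The bad points form a null set, covered by
    an open set of measure less than [d], on which absolute continuity keeps the total variation of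
    [h] along disjoint intervals below [e]. *)
Lemma absolutely_continuous_lipschitz h A B C : A <= B -> 0 <= C ->
  (forall e, 0 < e -> exists2 d : R, 0 < d & forall (m : nat) (a b : 'I_m -> R),
     (forall i, [/\ A <= a i, a i <= b i & b i <= B]) ->
     trivIset setT (fun i => `]a i, b i[%classic) ->
     \sum_(i < m) (b i - a i) < d -> \sum_(i < m) `|h (b i) - h (a i)| < e) ->
  {ae mu, forall t, A < t < B -> derivable h t 1 /\ `|derive1 h t| <= C} ->
  `|h B - h A| <= C * (B - A).
Proof.
move=> AB C0 ac [N [mN N0 badN]].
suff key e : 0 < e -> `|h B - h A| <= (C + e) * (B - A) + e.
  apply/ler_addgt0Pr => e e0.
  have BA0 : 0 < B - A + 1 by rewrite ltr_wpDl// subr_ge0.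
  have := key (e / (B - A + 1)) (divr_gt0 e0 BA0).
  congr (_ <= _); field; by rewrite gt_eqF.
move=> e0; have [d d0 acd] := ac e e0.
(* The derivative bound concerns the open interval only; counting [A] and [B] as bad makes every
   point of [A, B] outside [U] a good interior point. *)
pose N' := N `|` ([set A] `|` [set B]).
have N'0 : mu N' = 0%E.
  apply: null_set_setU => //; first exact: measurableU.
  by apply: null_set_setU => //; exact: lebesgue_measure_set1.
have mN' : measurable N' by do 2! apply: measurableU => //.
have N'oo : (mu N' < +oo)%E by rewrite N'0.
have [U [oU NU UN]] := lebesgue_regularity_outer mN' N'oo d0.
have Ud : (mu U < d%:E)%E.
  rewrite -(setDUK NU) setUC measureU0//.
  by apply: measurableD => //; exact: open_measurable.
(* [h] varies at rate at most [C + e] on [A, x], up to its variation over finitely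
   many disjoint intervals inside the small open set [U] of bad points. The
   supremum of such [x] is [B]. *)
pose P x := exists2 s, chain U A x s &
  `|h x - h A| <= (C + e) * (x - A) + \sum_(p <- s) `|h p.2 - h p.1|.
have PA : P A by exists [::] => //; rewrite !subrr normr0 mulr0 big_nil addr0.
have step u v : A <= u -> u <= v -> v <= B -> P u ->
    `|h v - h u| <= (C + e) * (v - u) \/ `[u, v] `<=` U -> P v.
  move=> Au uv vB [s [cs ps] hs] [good|sub].
    exists s.
      by split => // p /cs[? ? pu ?]; split => //; exact: le_trans uv.
    have -> : h v - h A = (h v - h u) + (h u - h A) by ring.
    apply: le_trans (ler_normD _ _) _; lra.
  exists (rcons s (u, v)).
    split => [p|]; last first.
      by rewrite pairwise_rcons ps andbT; apply/allP => p /cs[].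
    rewrite mem_rcons in_cons => /orP[/eqP->//|/cs[? ? pu ?]].
    by split => //; exact: le_trans uv.
  rewrite -cats1 big_cat big_seq1/=.
  have -> : h v - h A = (h v - h u) + (h u - h A) by ring.
  apply: le_trans (ler_normD _ _) _.
  have : (C + e) * (u - A) <= (C + e) * (v - A).
    by rewrite ler_wpM2l ?lerD2r// addr_ge0// ltW.
  lra.
have loc t : A <= t <= B -> exists2 r : R, 0 < r & forall u v,
    A <= u -> t - r < u -> u <= t -> t <= v -> v < t + r -> v <= B ->
    `|h v - h u| <= (C + e) * (v - u) \/ `[u, v] `<=` U.
  move=> /andP[At tB]; have [tU|tU] := pselect (U t).
    have /nbhs_ballP[r r0 rU] : nbhs t U by exact: open_nbhs_nbhs.
    exists r => // u v _ ru _ _ vr _; right => x /=; rewrite in_itv/= => /andP[ux xv].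
    apply: rU; rewrite /ball/= ltr_norml; apply/andP; split; lra.
  have tN : ~ N' t by move=> /NU.
  have At' : A < t.
    rewrite lt_neqAle At andbT; apply/eqP => tA; apply: tN; right; left; exact/esym.
  have tB' : t < B.
    rewrite lt_neqAle tB andbT; apply/eqP => tA; apply: tN; right; right; exact.
  have [dh hC] : derivable h t 1 /\ `|derive1 h t| <= C.
    apply: contrapT => bad; apply: tN; left; apply: badN => /= imp.
    by apply: bad; apply: imp; rewrite At' tB'.
  have [r r0 hr] := derivable_local_bound e0 dh hC.
  exists r => // u v Au ru ut tv vr vB; left.
  have -> : h v - h u = (h v - h t) - (h u - h t) by ring.
  apply: le_trans (ler_normB _ _) _.
  have h1 := hr v _; have h2 := hr u _.
  rewrite (ger0_norm (_ : 0 <= v - t)) ?subr_ge0// in h1.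
  rewrite (ler0_norm (_ : u - t <= 0)) ?subr_le0// in h2.
  have := h1 ltac:(lra); have := h2 ltac:(lra); lra.
have [s [cs ps] hs] : P B.
  pose S := [set x | A <= x <= B /\ P x].
  have SA : S A by split => //; rewrite lexx.
  have hS : has_sup S.
    by split; [exists A|exists B => x [/andP[]]].
  have cA : A <= sup S by apply: sup_upper_bound.
  have cB : sup S <= B by apply: sup_le_ub; [exists A|move=> x [/andP[]]].
  have [r r0 hr] := loc (sup S) ltac:(by rewrite cA cB).
  have [x [/andP[Ax xB] Px] xr] := sup_adherent r0 hS.
  have xc : x <= sup S by apply: sup_upper_bound => //; split => //; rewrite Ax.
  (* A point past the supremum, unless [B] comes first. As [P v] holds, [v] cannot exceed the
     supremum, and so [v] is [B]. *)
  pose v := Num.min B (sup S + r / 2).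
  have vB : v <= B by rewrite ge_min lexx.
  have cv : sup S <= v by rewrite le_min cB lerDl divr_ge0// ltW.
  have vr : v < sup S + r.
    rewrite gt_min; apply/orP; right; rewrite ltrD2l; lra.
  have Pv : P v.
    apply: (step x) => //; first exact: le_trans cv.
    exact: hr.
  have vc : v <= sup S.
    by apply: sup_upper_bound => //; split => //; rewrite vB (le_trans cA).
  have : v = B.
    move: vc; rewrite /v; case: (leP B (sup S + r / 2)) => //; lra.
  by move=> <-.
have [sd tI] := sum_chain_lt oU Ud (conj cs ps).
apply: le_trans hs _; rewrite lerD2l (big_nth (0%R, 0%R)) big_mkord; apply: ltW.
apply: acd => // i.
by have [] := cs _ (mem_nth (0%R, 0%R) (ltn_ord i)).
Qed.
End AbsoluteContinuity.

(** * Euclidean norm and distance to the boundary *)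

Section Euclidean.
Context {R : realType}.
Import ComplexField.Normc.

Lemma normc_ge0 (x : R[i]) : 0 <= normc x.
Proof. by case: x => a b; exact: sqrtr_ge0. Qed.

Lemma normc_le_sum (x : R[i]) :
  normc x <= `|complex.Re x| + `|complex.Im x|.
Proof.
case: x => a b /=; rewrite -[leRHS]ger0_norm ?addr_ge0// -sqrtr_sqr.
apply: ler_wsqrtr; rewrite sqrrD !real_normK ?num_real//.
by rewrite lerD2r lerDl mulrn_wge0// mulr_ge0.
Qed.

Lemma sqrt_sum_sqrD (I : finType) (a b : I -> R) :
  Num.sqrt (\sum_i (a i + b i) ^+ 2) <=
  Num.sqrt (\sum_i a i ^+ 2) + Num.sqrt (\sum_i b i ^+ 2).
Proof.
have s0 (c : I -> R) : 0 <= \sum_i c i ^+ 2 by apply: sumr_ge0 => i _; exact: sqr_ge0.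
set A := Num.sqrt (\sum_i a i ^+ 2); set B := Num.sqrt (\sum_i b i ^+ 2).
have A0 : 0 <= A := sqrtr_ge0 _; have B0 : 0 <= B := sqrtr_ge0 _.
have A2 : A ^+ 2 = \sum_i a i ^+ 2 by rewrite sqr_sqrtr.
have B2 : B ^+ 2 = \sum_i b i ^+ 2 by rewrite sqr_sqrtr.
have null (c : I -> R) : \sum_i c i ^+ 2 = 0 -> forall i, c i = 0.
  move=> /eqP; rewrite psumr_eq0; last by move=> i _; exact: sqr_ge0.
  by move=> /allP h i; apply/eqP; rewrite -sqrf_eq0; apply: h; rewrite mem_index_enum.
have CS : \sum_i a i * b i <= A * B.
  have [AE|A1] := eqVneq A 0.
    rewrite AE mul0r big1// => i _.
    by rewrite (null a) ?mul0r// -A2 AE expr0n.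
  have [BE|B1] := eqVneq B 0.
    rewrite BE mulr0 big1// => i _.
    by rewrite (null b) ?mulr0// -B2 BE expr0n.
  have Ap : 0 < A by rewrite lt_neqAle eq_sym A1.
  have Bp : 0 < B by rewrite lt_neqAle eq_sym B1.
  (* After multiplication by [2 A B], the Cauchy-Schwarz inequality is the sum over [i] of
     [(B a_i - A b_i)^2 >= 0]. *)
  rewrite -(ler_pM2r (mulr_gt0 (mulr_gt0 Ap Bp) (ltr0n R 2))).
  have -> : A * B * (A * B * 2) = B ^+ 2 * A ^+ 2 + A ^+ 2 * B ^+ 2 by ring.
  rewrite {1}A2 {2}B2 mulr_suml !mulr_sumr -big_split/=.
  apply: ler_sum => i _; rewrite -subr_ge0.
  have -> : B ^+ 2 * a i ^+ 2 + A ^+ 2 * b i ^+ 2 - a i * b i * (A * B * 2) =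
            (B * a i - A * b i) ^+ 2 by ring.
  exact: sqr_ge0.
rewrite -(ler_pXn2r (ltn0Sn 1)) ?nnegrE ?addr_ge0// ?sqrtr_ge0// sqr_sqrtr//.
have -> : \sum_i (a i + b i) ^+ 2 = A ^+ 2 + 2 * (\sum_i a i * b i) + B ^+ 2.
  rewrite A2 B2 mulr_sumr -!big_split/=; apply: eq_bigr => i _; ring.
rewrite sqrrD -mulr_natl; lra.
Qed.

Context {n : nat}.
Implicit Types (Omega V W : set 'rV[R[i]]_n) (z v w : 'rV[R[i]]_n).

Lemma enormE z : enorm z = Num.sqrt (\sum_j normc (z ord0 j) ^+ 2).
Proof.
congr Num.sqrt; apply: eq_bigr => j _; case: (z ord0 j) => x y /=.
by rewrite sqr_sqrtr// addr_ge0// sqr_ge0.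
Qed.

Lemma enorm_ge0 z : 0 <= enorm z. Proof. exact: sqrtr_ge0. Qed.

Lemma enormN z : enorm (- z) = enorm z.
Proof.
rewrite !enormE; congr Num.sqrt; apply: eq_bigr => j _.
by rewrite mxE normcN.
Qed.

Lemma enormB z w : enorm (z - w) = enorm (w - z).
Proof. by rewrite -enormN opprB. Qed.

Lemma enorm0 : enorm (0 : 'rV[R[i]]_n) = 0.
Proof.
by rewrite /enorm big1 ?sqrtr0// => j _; rewrite mxE/= expr0n addr0.
Qed.

Lemma enormZ (c : R) z : enorm (c%:C *: z) = `|c| * enorm z.
Proof.
rewrite -(sqrtr_sqr c) /enorm -sqrtrM ?sqr_ge0// mulr_sumr; congr Num.sqrt.
by apply: eq_bigr => j _; rewrite mxE; case: (z ord0 j) => x y /=; ring.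
Qed.

Lemma enormD z w : enorm (z + w) <= enorm z + enorm w.
Proof.
rewrite !enormE; apply: le_trans (sqrt_sum_sqrD _ _).
apply: ler_wsqrtr; apply: ler_sum => j _.
rewrite ler_pXn2r// ?nnegrE ?addr_ge0 ?normc_ge0//.
by rewrite mxE le_normcD.
Qed.

Lemma enorm_triangle u z w : enorm (z - w) <= enorm (z - u) + enorm (u - w).
Proof. by apply: le_trans (enormD _ _); rewrite addrA subrK. Qed.

Lemma normc_le_enorm z j : normc (z ord0 j) <= enorm z.
Proof.
rewrite enormE -[leLHS]ger0_norm ?normc_ge0// -sqrtr_sqr; apply: ler_wsqrtr.
rewrite (bigD1 j)//= lerDl; apply: sumr_ge0 => i _; exact: sqr_ge0.
Qed.

Lemma enorm_le_sum_normc z : enorm z <= \sum_j normc (z ord0 j).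
Proof.
have S0 : 0 <= \sum_j normc (z ord0 j) by apply: sumr_ge0 => j _; exact: normc_ge0.
rewrite enormE -[leRHS]ger0_norm// -sqrtr_sqr; apply: ler_wsqrtr.
rewrite expr2 mulr_suml; apply: ler_sum => j _; rewrite expr2.
by rewrite ler_wpM2l ?normc_ge0// (bigD1 j)//= lerDl; apply: sumr_ge0 => i _;
  exact: normc_ge0.
Qed.


Lemma Re_le_enorm z j : `|complex.Re (z ord0 j)| <= enorm z.
Proof.
apply: le_trans (normc_le_enorm z j); case: (z ord0 j) => x y /=.
by rewrite -sqrtr_sqr ler_wsqrtr// lerDl sqr_ge0.
Qed.

Lemma Im_le_enorm z j : `|complex.Im (z ord0 j)| <= enorm z.
Proof.
apply: le_trans (normc_le_enorm z j); case: (z ord0 j) => x y /=.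
by rewrite -sqrtr_sqr ler_wsqrtr// lerDr sqr_ge0.
Qed.

Lemma enorm_le_sum z :
  enorm z <= \sum_j (`|complex.Re (z ord0 j)| + `|complex.Im (z ord0 j)|).
Proof.
apply: le_trans (enorm_le_sum_normc z) _.
by apply: ler_sum => j _; exact: normc_le_sum.
Qed.

(** The bridge to the library topology: the modulus of a coordinate is at most the Euclidean norm,
    which is at most the sum of these moduli. All later topology goes through this
    characterization. *)
Lemma nbhs_enormP z V :
  nbhs z V <-> exists2 e : R, 0 < e & forall w, enorm (z - w) < e -> V w.
Proof.
split=> [/nbhs_ballP[[e e'] /= e0 eV]|[e e0 eV]].
  move: e0; rewrite ltcE/= => /andP[/eqP e'0 e0].
  exists e => // w zw; apply: eV; split=> [|i j]; first by rewrite ltcE/= e'0 eqxx.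
  rewrite /ball/= ord1.
  have -> : z ord0 j - w ord0 j = (z - w) ord0 j by rewrite !mxE.
  rewrite e'0 -[`|_|]/((normc _)%:C) ltcR.
  exact: le_lt_trans (normc_le_enorm _ _) zw.
(* Dividing by [n.+1] instead of [n] covers dimension 0 and makes the final inequality strict. *)
have n0 : 0 < n.+1%:R :> R by rewrite ltr0n.
apply/nbhs_ballP; exists (e / n.+1%:R)%:C; first by rewrite /= ltcR divr_gt0.
move=> w [_ zw]; apply: eV; apply: le_lt_trans (enorm_le_sum_normc _) _.
apply: (@le_lt_trans _ _ (\sum_(j < n) (e / n.+1%:R))).
  apply: ler_sum => j _; apply: ltW.
  have := zw ord0 j; rewrite /ball/=.
  have -> : z ord0 j - w ord0 j = (z - w) ord0 j by rewrite !mxE.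
  by rewrite -[`|_|]/((normc _)%:C) ltcR.
rewrite sumr_const card_ord -[X in X < _]mulr_natr -mulrA gtr_pMr//.
by rewrite mulrC ltr_pdivrMr// mul1r ltr_nat.
Qed.

Lemma closure_enormP V z :
  closure V z <-> forall e : R, 0 < e -> exists2 w, V w & enorm (z - w) < e.
Proof.
split=> [clV e e0|clV B /nbhs_enormP[e e0 eB]].
  have /clV[w [Vw zw]] : nbhs z [set w | enorm (z - w) < e].
    by apply/nbhs_enormP; exists e.
  by exists w.
by have [w Vw zw] := clV e e0; exists w; split => //; exact: eB.
Qed.

Lemma enorm_lipschitz_continuous (F : 'rV[R[i]]_n -> R) :
  (forall z w, `|F z - F w| <= enorm (z - w)) -> continuous F.
Proof.
move=> lipF z B /nbhs_ballP[e e0 eB].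
apply/nbhs_enormP; exists e => // w zw; apply: eB.
exact: le_lt_trans (lipF z w) zw.
Qed.

Lemma compact_complex_square (M : R) :
  compact [set x : R[i] | `|complex.Re x| <= M /\ `|complex.Im x| <= M].
Proof.
pose f (p : R * R) : R[i] := p.1 +i* p.2.
have cf : continuous f.
  move=> [a b]; apply/cvgrPdist_lt => -[e e'] /=; rewrite ltcE/= => /andP[/eqP e'0 e0].
  have e20 : 0 < e / 2 by rewrite divr_gt0.
  have h : nbhs (a, b) [set p | `|a - p.1| < e / 2 /\ `|b - p.2| < e / 2].
    by exists (ball a (e / 2), ball b (e / 2)); [split; exact: nbhsx_ballx|].
  apply: filterS h => -[x y] /= [ax by_]; rewrite e'0.
  rewrite -[`|_|]/((normc _)%:C) ltcR.
  by apply: le_lt_trans (normc_le_sum _) _ => /=; lra.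
have -> : [set x : R[i] | `|complex.Re x| <= M /\ `|complex.Im x| <= M] =
    f @` (`[- M, M]%classic `*` `[- M, M]%classic).
  apply/seteqP; split => [[x y] /= [xM yM]|_ [[x y] /= [xM yM] <-]/=].
    by exists (x, y) => //=; rewrite !in_itv/= -!ler_norml.
  by move: xM yM; rewrite !in_itv/= -!ler_norml.
apply: continuous_compact; first exact: continuous_subspaceT.
by apply: compact_setX; exact: segment_compact.
Qed.

Lemma bounded_closed_compact_complex V (M : R) : closed V ->
  (forall z, V z -> enorm z <= M) -> compact V.
Proof.
move=> clV VM.
apply: (subclosed_compact clV (rV_compact (fun=> @compact_complex_square M))).
move=> z /VM zM /= j; split; apply: le_trans zM.
  exact: Re_le_enorm.
exact: Im_le_enorm.
Qed.

Lemma bounded_set_enorm V : bounded_set V -> exists M : R, forall z, V z -> enorm z <= M.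
Proof.
move=> [M [Mreal hM]].
pose x := M + 1; have Mx : M < x by rewrite ltrDl.
exists (n%:R * complex.Re (x + 1)) => z Vz.
have : ball (0 : 'rV[R[i]]_n) (x + 1) z.
  rewrite mx_norm_ball /ball_/= sub0r normrN.
  by apply: le_lt_trans (hM _ Mx z Vz) _; rewrite ltrDl.
move=> [_ zx]; apply: le_trans (enorm_le_sum_normc z) _.
rewrite mulr_natl -[X in _ *+ X]card_ord -sumr_const; apply: ler_sum => j _.
have := zx ord0 j; rewrite /ball/= mxE sub0r normrN.
rewrite -[`|_|]/((normc _)%:C) ltcE/= => /andP[_].
exact: ltW.
Qed.

Lemma bounded_closure_compact Omega V : bounded_set Omega ->
  V `<=` closure Omega -> closed V -> compact V.
Proof.
move=> /bounded_set_enorm[M hM] VO clV.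
apply: (@bounded_closed_compact_complex _ (M + 1)) => // z /VO /closure_enormP.
move=> /(_ 1 ltr01)[w /hM wM zw].
rewrite -(subrK w z); apply: le_trans (enormD _ _) _; lra.
Qed.

Section BoundaryDist.
Variable (Omega : set 'rV[R[i]]_n).
Hypothesis coOmega : ~` Omega !=set0.

Let has_inf_dist z : has_inf [set enorm (z - w) | w in ~` Omega].
Proof.
split; first by have [w Ow] := coOmega; exists (enorm (z - w)); exists w.
by exists 0 => _ [w _ <-]; exact: enorm_ge0.
Qed.

Lemma boundary_dist_le z w : ~ Omega w -> boundary_dist Omega z <= enorm (z - w).
Proof. by move=> Ow; apply: (ge_inf (has_inf_dist z).2); exists w. Qed.

Lemma le_boundary_dist z r : (forall w, ~ Omega w -> r <= enorm (z - w)) ->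
  r <= boundary_dist Omega z.
Proof.
move=> h; apply: lb_le_inf; first exact: (has_inf_dist z).1.
by move=> _ [w Ow <-]; exact: h.
Qed.

Lemma boundary_dist_lipschitz z w :
  `|boundary_dist Omega z - boundary_dist Omega w| <= enorm (z - w).
Proof.
have h u v : boundary_dist Omega u - enorm (u - v) <= boundary_dist Omega v.
  apply: le_boundary_dist => x Ox.
  have := boundary_dist_le u Ox; have := enorm_triangle v u x; lra.
rewrite ler_norml; have := h z w; have := h w z; rewrite (enormB w z).
by move=> h1 h2; apply/andP; split; lra.
Qed.

Lemma boundary_dist_ge0 z : 0 <= boundary_dist Omega z.
Proof. by apply: le_boundary_dist => w _; exact: enorm_ge0. Qed.

Lemma boundary_dist_out z : ~ Omega z -> boundary_dist Omega z = 0.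
Proof.
move=> Oz; apply/eqP; rewrite eq_le boundary_dist_ge0 andbT.
by rewrite -enorm0 -(subrr z); exact: boundary_dist_le.
Qed.

Lemma boundary_dist_gt0 z : open Omega -> Omega z -> 0 < boundary_dist Omega z.
Proof.
move=> oO Oz; have /nbhs_enormP[e e0 eO] : nbhs z Omega by exact: open_nbhs_nbhs.
apply: lt_le_trans e0 _; apply: le_boundary_dist => w Ow; rewrite leNgt.
by apply/negP => /eO.
Qed.

Lemma continuous_boundary_dist : continuous (boundary_dist Omega).
Proof. exact/enorm_lipschitz_continuous/boundary_dist_lipschitz. Qed.

(** Sets of this form serve as the compact set in the definition of visibility. They lie in [Omega]
    because [boundary_dist] vanishes outside it. *)
Lemma compact_boundary_dist_ge (e : R) : 0 < e -> bounded_set Omega ->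
  compact [set z | e <= boundary_dist Omega z] /\
  [set z | e <= boundary_dist Omega z] `<=` Omega.
Proof.
move=> e0 bO.
have KO : [set z | e <= boundary_dist Omega z] `<=` Omega.
  move=> z /= ez; apply: contrapT => /boundary_dist_out dz.
  by move: ez; rewrite dz leNgt e0.
split => //; apply: (bounded_closure_compact bO).
  by apply: subset_trans KO _; exact: subset_closure.
rewrite -[mkset _]/(boundary_dist Omega @^-1` [set x | e <= x]).
by apply: closed_comp; [move=> x _; exact: continuous_boundary_dist|exact: closed_ge].
Qed.
End BoundaryDist.

(** Ensures that [boundary_dist] is a genuine infimum and not the default value of [inf] on the
    empty set. In dimension 0 the whole space is bounded, hence the condition on [n]. *)
Lemma bounded_setC_neq0 Omega : (0 < n)%N -> bounded_set Omega -> ~` Omega !=set0.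
Proof.
move=> n0 /bounded_set_enorm[M hM]; apply/set0P/eqP => co.
have OT : Omega = setT by rewrite -(setCK Omega) co setC0.
have M0 : 0 <= M by apply: le_trans (hM 0 _); [exact: enorm_ge0|rewrite OT].
have := hM (const_mx (M + 1)%:C); rewrite OT => /(_ I).
have := Re_le_enorm (const_mx (M + 1)%:C) (Ordinal n0).
rewrite mxE/= ger0_norm ?addr_ge0//; lra.
Qed.

(** [boundary_dist] of the complement of [W] is the distance to [W]. It attains its minimum on the
    compact closure of [V], and a zero minimum would give a common point of the two closures. *)
Lemma separated_closures Omega V W : bounded_set Omega ->
  V `<=` closure Omega -> W !=set0 ->
  closure V `&` closure W = set0 ->
  exists2 e : R, 0 < e & forall v w, V v -> W w -> e <= enorm (v - w).
Proof.
move=> bO VO [w0 Ww0] VW.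
have coW : ~` ~` W !=set0 by rewrite setCK; exists w0.
have [V0|/set0P V0] := eqVneq (closure V) set0.
  exists 1 => // v w Vv; have : closure V v by exact: subset_closure.
  by rewrite V0.
have cV : compact (closure V).
  apply: (bounded_closure_compact bO); last exact: closed_closure.
  apply: subset_trans (closureS VO) _.
  by rewrite -(closure_id _).1//; exact: closed_closure.
have cd : {within closure V, continuous (boundary_dist (~` W))}.
  by apply: continuous_subspaceT; exact: continuous_boundary_dist.
have [p /set_mem clp hp] := compact_EVT_min V0 cV cd.
exists (boundary_dist (~` W) p).
  rewrite lt_neqAle boundary_dist_ge0// andbT eq_sym; apply/eqP => p0.
  suff : (closure V `&` closure W) p by rewrite VW.
  split => //; apply/closure_enormP => e e0; apply: contrapT => h.
  have : e <= boundary_dist (~` W) p.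
    apply: le_boundary_dist => // w /contrapT Ww.
    rewrite leNgt; apply/negP => pw; apply: h; by exists w.
  by rewrite p0 leNgt e0.
move=> v w Vv Ww.
apply: le_trans (hp v _) _; first by rewrite inE; exact: subset_closure.
by apply: boundary_dist_le => //; move=> /(_ Ww).
Qed.

End Euclidean.

(** * Speed and levels *)

Section MBound.
Context {R : realType} {n : nat}.
Implicit Types (Omega : set 'rV[R[i]]_n) (z v : 'rV[R[i]]_n).

Lemma kobayashi_M_le Omega (r s : R) : r <= s ->
  (kobayashi_M Omega r <= kobayashi_M Omega s)%E.
Proof.
move=> rs; apply: le_ereal_sup => _ [z [v [Oz zr v1 ->]]].
by exists z, v; split => //; exact: le_trans rs.
Qed.

(** The witnesses [z] and [v] exclude the supremum of the empty set, which is [-oo]. *)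
Lemma kobayashi_M_ge0 Omega (r : R) z v :
  Omega z -> boundary_dist Omega z <= r -> enorm v = 1 ->
  (0 <= kobayashi_M Omega r)%E.
Proof.
move=> Oz zr v1; apply: (@le_trans _ _ ((kobayashi_metric Omega z v)^-1)%E).
  by rewrite inve_ge0 kobayashi_metric_ge0.
by apply: ereal_sup_ubound; exists z, v.
Qed.

(** Converts a Kobayashi speed into a Euclidean one: after normalization of [v], the inverse of its
    metric is one of the values whose supremum is [M]. *)
Lemma enorm_le_kobayashi_M Omega z v (r m lambda : R) : 0 < lambda -> 0 <= m ->
  Omega z -> boundary_dist Omega z <= r -> (kobayashi_M Omega r <= m%:E)%E ->
  (kobayashi_metric Omega z v <= lambda%:E)%E -> enorm v <= lambda * m.
Proof.
move=> l0 m0 Oz zr Mm kv.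
have [->|v0] := eqVneq (enorm v) 0; first by rewrite mulr_ge0// ltW.
have vp : 0 < enorm v by rewrite lt_neqAle eq_sym v0 enorm_ge0.
pose u := ((enorm v)^-1)%:C *: v.
have u1 : enorm u = 1 by rewrite enormZ gtr0_norm ?invr_gt0// mulVf.
have ku : (kobayashi_metric Omega z u <= (lambda / enorm v)%:E)%E.
  apply: le_trans (kobayashi_metricZ_le _ _ _ _) _; first by rewrite invr_eq0.
  by rewrite gtr0_norm ?invr_gt0// mulrC EFinM lee_pmul2l// lte_fin invr_gt0.
have : ((enorm v / lambda)%:E <= kobayashi_M Omega r)%E.
  apply: (@le_trans _ _ ((kobayashi_metric Omega z u)^-1)%E); last first.
    by apply: ereal_sup_ubound; exists z, u.
  have := kobayashi_metric_ge0 Omega z u; move: ku.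
  case: (kobayashi_metric _ _ _) => [x| |]//; rewrite !lee_fin => xle x0.
  (* If the metric vanishes at [u], its inverse in [\bar R] is [+oo] and the bound is trivial. *)
  rewrite inver; case: ifPn => [_|xn0]; first exact: leey.
  have xp : 0 < x by rewrite lt_neqAle eq_sym xn0.
  by rewrite lee_fin -[leLHS]invrK invf_div lef_pV2// posrE divr_gt0.
move=> /le_trans/(_ Mm); rewrite lee_fin ler_pdivrMr// mulrC; lra.
Qed.
End MBound.

(** * Levels of f and summability of M along them *)

Section Levels.
Context {R : realType}.
Variable f : R -> R.
Hypothesis df : forall t : R, 0 < t -> derivable f t 1 /\ {for t, continuous (derive1 f)}.
Hypothesis f_incr : forall s t : R, 0 < s -> s < t -> f s < f t.
Notation mu := (@lebesgue_measure R).

(** The weight of the integral hypothesis. It is the derivative of [- f (1 / r)], so its integral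
    over an interval is the variation of [f (1 / r)] there. *)
Let density (r : R) := r ^- 2 * derive1 f (1 / r).

Lemma is_derive_opp_comp_inv (r : R) : 0 < r ->
  is_derive r (1 : R) (fun x => - f (1 / x)) (density r).
Proof.
move=> r0; have rn0 : r != 0 by rewrite gt_eqF.
have hinv : is_derive r (1 : R) (fun x : R => 1 / x) (- r ^- 2).
  have -> : (fun x : R => 1 / x) = (fun x => x^-1) by apply/funext => x; rewrite div1r.
  apply: DeriveDef; first exact: (@derivableV _ _ (@id R)).
  rewrite (@deriveV _ _ (@id R))// derive_id.
  by rewrite -[LHS]/(_ * 1) mulr1.
have [dfr _] := df (divr_gt0 ltr01 r0).
have hf : is_derive (1 / r) (1 : R) f (derive1 f (1 / r)).
  by rewrite derive1E; exact: derivableP.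
have h := is_deriveN (@is_derive1_comp _ f (fun x => 1 / x) r _ _ hf hinv).
apply: is_derive_eq h _; rewrite /density; ring.
Qed.

Lemma derive1_incr_ge0 (t : R) : 0 < t -> 0 <= derive1 f t.
Proof.
move=> t0; apply: (@incr_derive1_ge0_itvy _ f false 0).
- by move=> x /set_mem; rewrite /= in_itv/= andbT => x0; exact: (df x0).1.
- by move=> x y; rewrite !in_itv/= !andbT => x0 _; exact: f_incr.
- by rewrite in_itv/= t0.
Qed.

Lemma density_ge0 (r : R) : 0 < r -> 0 <= density r.
Proof.
move=> r0; rewrite mulr_ge0//; first by rewrite invr_ge0 sqr_ge0.
by apply: derive1_incr_ge0; rewrite divr_gt0.
Qed.

Lemma continuous_density (r : R) : 0 < r -> {for r, continuous density}.
Proof.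
move=> r0; have rn0 : r != 0 by rewrite gt_eqF.
have inv : (fun x : R => 1 / x) @ r --> 1 / r.
  have [d _] := is_derive_opp_comp_inv r0.
  by apply: cvgM; [exact: cvg_cst|apply: cvgV].
apply: (@cvgM _ R^o).
  by apply: cvgV; [rewrite expf_eq0//|exact: exprn_continuous].
have [_ cf] := df (divr_gt0 ltr01 r0).
exact: cvg_comp inv cf.
Qed.

Lemma integral_density (a b : R) : 0 < a -> a < b ->
  (\int[mu]_(r in `[a, b[) (density r)%:E = (f (1 / a) - f (1 / b))%:E)%E.
Proof.
move=> a0 ab.
have pos x : x \in `[a, b] -> 0 < x.
  by rewrite in_itv/= => /andP[ax _]; exact: lt_le_trans a0 ax.
have cd : {within `[a, b], continuous density}.
  by apply: continuous_in_subspaceT => x /set_mem/pos; exact: continuous_density.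
have cF (x : R) : 0 < x -> {for x, continuous (fun y : R => - f (1 / y) : R)}.
  move=> x0; have [d _] := is_derive_opp_comp_inv x0.
  exact/differentiable_continuous/derivable1_diffP.
have md : measurable_fun `]a, b[ (fun r => (density r)%:E).
  apply/measurable_EFinP.
  apply: measurable_funS (subspace_continuous_measurable_fun _ cd) => //.
  by apply: subset_itv; rewrite bnd_simp.
rewrite integral_itv_bndoo// -(@integral_itv_bndoo _ _ _ _ true false)//.
rewrite (@continuous_FTC2 _ density (fun x => - f (1 / x)) a b)//.
- by rewrite -EFinB opprK addrC.
- split.
  + by move=> x; rewrite in_itv/= => /andP[ax _];
      have [] := is_derive_opp_comp_inv (lt_trans a0 ax).
  + by apply: cvg_at_right_filter; exact: cF.
  + by apply: cvg_at_left_filter; apply: cF; exact: lt_trans ab.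
- move=> x; rewrite in_itv/= => /andP[ax _].
  by rewrite derive1E; have [_ ->] := is_derive_opp_comp_inv (lt_trans a0 ax).
Qed.

Lemma exists_level (a c : R) : f t @[t --> +oo] --> +oo -> 0 < a -> f a < c ->
  exists2 s, a < s & f s = c.
Proof.
move=> foo a0 fac; move/cvgryPge : foo => /(_ c)[X [_ hX]].
pose b := Num.max (a + 1) (X + 1).
have ab : a < b by rewrite lt_max ltrDl ltr01.
have cb : c <= f b by apply: hX; rewrite lt_max orbC ltrDl ltr01.
have cf : {within `[a, b], continuous f}.
  apply: continuous_in_subspaceT => x /set_mem; rewrite /= in_itv/= => /andP[ax _].
  have [d _] := df (lt_le_trans a0 ax).
  exact/differentiable_continuous/derivable1_diffP.
have [|s] := IVT (ltW ab) cf (v := c).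
  by rewrite ge_min (ltW fac)/= le_max cb orbT.
rewrite in_itv/= => /andP[as_ _] fs; exists s => //.
by rewrite lt_neqAle as_ andbT; apply/eqP => E; move: fac; rewrite E fs ltxx.
Qed.

Lemma incr_leE (s t : R) : 0 < s -> 0 < t -> (f s <= f t) = (s <= t).
Proof.
move=> s0 t0; case: (leP s t) => [|ts]; last by rewrite leNgt f_incr.
by rewrite le_eqVlt => /orP[/eqP->|/(f_incr s0)/ltW//]; rewrite lexx.
Qed.

Lemma exists_summable_levels (M : R -> \bar R) (r0 : R) :
  f t @[t --> +oo] --> +oo -> 0 < r0 ->
  (forall r : R, 0 < r -> (0 <= M r)%E) -> (forall r s : R, r <= s -> (M r <= M s)%E) ->
  M t @[t --> 0^'+] --> 0%E ->
  (\int[mu]_(r in `]0%R, r0[) (M r * (density r)%:E) < +oo)%E ->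
  exists (k0 : nat) (r : nat -> R) (I : R),
    (forall k, [/\ 0 < r k, f (1 / r k) = (k0 + k)%:R & M (r k) \is a fin_num]) /\
    forall N, \sum_(k < N) fine (M (r k)) <= I.
Proof.
move=> foo r00 M0 Mle Mcvg intM.
have [r1 [r10 r1r0 Mr1]] : exists r1 : R, [/\ 0 < r1, r1 < r0 & M r1 \is a fin_num].
  have : nbhs (0%E : \bar R) [set x | (x < 1%:E)%E].
    by apply: open_nbhs_nbhs; split; [exact: open_ereal_lt_ereal|rewrite /= lte_fin].
  move=> /Mcvg h1.
  have /nbhs_ballP[e /= e0 he] : nbhs (0 : R) (fun t => 0 < t -> (M t < 1%:E)%E) := h1.
  pose r1 := Num.min (e / 2) (r0 / 2).
  have r10 : 0 < r1 by rewrite lt_min !divr_gt0.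
  exists r1; split => //.
    by rewrite gt_min; apply/orP; right; lra.
  rewrite ge0_fin_numE ?M0//; apply: lt_trans (he r1 _ r10) _; last exact: ltry.
  rewrite /ball/= sub0r normrN gtr0_norm// gt_min; apply/orP; left; lra.
have Mfin (r : R) : 0 < r -> r <= r1 -> M r \is a fin_num.
  move=> rp rr1; rewrite ge0_fin_numE ?M0//.
  by rewrite (le_lt_trans (Mle _ _ rr1))// ltey_eq Mr1.
(* A real-valued substitute for [M] that equals it on []0, r1]]. Freezing it beyond [r1] and setting
   it to 0 for [r <= 0] makes it nondecreasing on the whole line, hence measurable. *)
pose H (r : R) := if 0 < r then fine (M (Num.min r r1)) else 0.
have Hge0 (r : R) : 0 <= H r.
  by rewrite /H; case: ifPn => // rp; rewrite fine_ge0// M0// lt_min rp.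
have HM (r : R) : 0 < r -> r <= r1 -> M r = (H r)%:E.
  by move=> rp rr1; rewrite /H rp min_l// fineK// Mfin.
have Hnd : {homo H : x y / x <= y}.
  move=> r s rs; rewrite {1}/H; case: ifPn => rp //.
  rewrite /H (lt_le_trans rp rs); apply: fine_le.
  - by apply: Mfin; rewrite ?lt_min ?rp// ge_min lexx orbT.
  - by apply: Mfin; rewrite ?lt_min ?(lt_le_trans rp rs)// ge_min lexx orbT.
  - by apply: Mle; rewrite le_min !ge_min rs lexx/= orbT.
have mH : measurable_fun [set: R] H by exact: nondecreasing_measurable.
(* Starting the levels above [f (1 / r1)] keeps every [r k] below [r1], where [M] is finite. *)
have [k0 hk0] : exists k0 : nat, f (1 / r1) < k0%:R.
  exists (Num.bound `|f (1 / r1)|); apply: le_lt_trans (ler_norm _) _.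
  exact: archi_boundP.
have r1V : 0 < 1 / r1 by rewrite divr_gt0.
have lev k : exists r : R, [/\ 0 < r, r < r1 & f (1 / r) = (k0 + k)%:R].
  have [|s r1s fs] := exists_level (c := (k0 + k)%:R) foo r1V.
    by apply: lt_le_trans hk0 _; rewrite ler_nat leq_addr.
  have s0 : 0 < s := lt_trans r1V r1s.
  exists s^-1; rewrite invr_gt0 s0 div1r invrK; split => //.
  by move: r1s; rewrite div1r -{1}[s]invrK ltf_pV2// posrE invr_gt0.
pose r (k : nat) : R := xget 0 [set r | [/\ 0 < r, r < r1 & f (1 / r) = (k0 + k)%:R]].
have hr k : [/\ 0 < r k, r k < r1 & f (1 / r k) = (k0 + k)%:R].
  by rewrite /r; case: xgetP => [y _ //|/(_ _)] h; have [y /h] := lev k.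
have rdec k : r k.+1 < r k.
  have [p1 _ e1] := hr k.+1; have [p2 _ e2] := hr k.
  rewrite ltNge -[leLHS]invrK -[leRHS]invrK lef_pV2 ?posrE ?invr_gt0//.
  rewrite -[leLHS]div1r -[leRHS]div1r -incr_leE ?divr_gt0// e1 e2 ler_nat.
  by rewrite -ltnNge addnS.
have md (a b : R) : 0 < a -> measurable_fun `[a, b[ density.
  move=> a0; have cd : {within `[a, b], continuous density}.
    apply: continuous_in_subspaceT => x /set_mem; rewrite /= in_itv/= => /andP[ax _].
    by apply: continuous_density; exact: lt_le_trans ax.
  apply: measurable_funS (subspace_continuous_measurable_fun _ cd) => //.
  by apply: subset_itv; rewrite bnd_simp.
have mHd (a b : R) : 0 < a -> measurable_fun `[a, b[ (fun r => (H r * density r)%:E).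
  move=> a0; apply/measurable_EFinP; apply: measurable_funM; last exact: md.
  exact: measurable_funTS.
have rle N : r N <= r 0%N.
  by elim: N => // N; apply: le_trans; exact/ltW/rdec.
have Hd0 (x a b : R) : 0 < a -> `[a, b[%classic x -> (0 <= (H x * density x)%:E)%E.
  move=> a0; rewrite /= in_itv/= => /andP[ax _].
  by rewrite lee_fin mulr_ge0// density_ge0// (lt_le_trans a0).
(* The index is [k.+1] because a nondecreasing [H] is bounded below on [[r k.+1, r k[] by its value
   at the left end. *)
have key N : ((\sum_(k < N) H (r k.+1))%:E <=
    \int[mu]_(x in `[r N, r 0%N[) (H x * density x)%:E)%E.
  elim: N => [|N IH].
    rewrite big_ord0; apply: integral_ge0 => x.
    by apply: Hd0; have [] := hr 0%N.
  have [p1 _ e1] := hr N.+1; have [p2 _ e2] := hr N.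
  have U : `[r N.+1, r 0%N[%classic =
      `[r N.+1, r N[%classic `|` `[r N, r 0%N[%classic :> set R.
    apply: itv_bndbnd_setU; rewrite bnd_simp; first exact/ltW/rdec.
    exact: rle.
  rewrite U ge0_integral_setU//=; last 3 first.
  - by rewrite -U; exact: mHd.
  - by move=> x [|]; exact: Hd0.
  - apply/disj_setPS => x /= []; rewrite !in_itv/= => /andP[_ h1] /andP[h2 _].
    by move: h1; rewrite ltNge h2.
  have fe : f (1 / r N.+1) - f (1 / r N) = 1 by rewrite e1 e2 addnS -natr1; ring.
  rewrite big_ord_recr/= EFinD addeC; apply: leeD IH.
  have -> : ((H (r N.+1))%:E =
      \int[mu]_(x in `[r N.+1, r N[) ((H (r N.+1))%:E * (density x)%:E))%E.
    rewrite ge0_integralZl//=.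
    - by rewrite integral_density// fe mule1.
    - by apply/measurable_EFinP; exact: md.
    - move=> x; rewrite in_itv/= => /andP[rx _].
      by rewrite lee_fin density_ge0// (lt_le_trans p1).
    - by rewrite lee_fin Hge0.
  apply: le_integral_nonmeasurable => //.
  - move=> x; rewrite /= in_itv/= => /andP[rx _].
    by rewrite -EFinM lee_fin mulr_ge0// density_ge0// (lt_le_trans p1).
  - by move=> x; exact: Hd0.
  - move=> x; rewrite /= in_itv/= => /andP[rx _].
    rewrite -EFinM lee_fin ler_wpM2r ?density_ge0// ?(lt_le_trans p1)//.
    exact: Hnd.
pose I := fine (\int[mu]_(r in `]0%R, r0[) (M r * (density r)%:E)).
(* The integral bounds the terms of index at least 1; the term of index 0 is added separately.
   Passing from [N] to [N.+1] below makes it available to split off even when [N] is 0. *)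
exists k0, r, (H (r 0%N) + I); split.
  by move=> k; have [p1 p2 p3] := hr k; split => //; rewrite Mfin// ltW.
have mono N : \sum_(k < N) fine (M (r k)) <= \sum_(k < N.+1) fine (M (r k)).
  rewrite big_ord_recr/= lerDl fine_ge0// M0//; by have [] := hr N.
move=> N; apply: le_trans (mono N) _; rewrite big_ord_recl/=.
have fH k : fine (M (r k)) = H (r k).
  by have [p1 p2 _] := hr k; rewrite HM// ltW.
rewrite fH lerD2l; under eq_bigr do rewrite fH.
have Md0 (x : R) : 0 < x -> (0 <= M x * (density x)%:E)%E.
  by move=> x0; rewrite mule_ge0 ?M0// lee_fin density_ge0.
rewrite -lee_fin /I fineK; last first.
  rewrite ge0_fin_numE//; apply: integral_ge0 => x; rewrite /= in_itv/= => /andP[x0 _].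
  exact: Md0.
have [pN _ _] := hr N; have [_ p01 _] := hr 0%N.
apply: le_trans (key N) _; apply: le_integral_nonmeasurable.
- move=> x; rewrite /= !in_itv/= => /andP[rx xr].
  by rewrite (lt_le_trans pN rx) (lt_trans xr)// (lt_trans p01).
- by move=> x; exact: Hd0.
- by move=> x; rewrite /= in_itv/= => /andP[x0 _]; exact: Md0.
- move=> x; rewrite /= in_itv/= => /andP[rx xr].
  by rewrite HM ?EFinM// ?(lt_le_trans pN)// ltW// (lt_trans xr).
Qed.
End Levels.

(** * Almost-geodesics *)

Section Chain.
Context {R : realType}.

Lemma bounded_series_tail (u : nat -> R) (I e : R) : (forall k, 0 <= u k) ->
  (forall N, \sum_(k < N) u k <= I) -> 0 < e ->
  exists K, forall N, \sum_(k < N) u (K + k)%N <= e.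
Proof.
move=> u0 uI e0; pose S := range (fun N => \sum_(k < N) u k).
have hS : has_sup S.
  by split; [exists (\sum_(k < 0) u k), 0%N|exists I => _ [N _ <-]].
have [_ [K _ <-] hK] := sup_adherent e0 hS; exists K => N.
have : \sum_(k < K + N) u k <= sup S by apply: sup_upper_bound => //; exists (K + N)%N.
rewrite big_split_ord/=; lra.
Qed.

(** The near part lasts at most [c 0] at rate [A]. Between [c k] and [c k.+1], a time of at most
    [w], the rate is [a k], and these contributions are summed until some [c N] passes [X]. *)
Lemma chain_displacement (p : R -> R) (X A w S : R) (c a : nat -> R) :
  0 <= X -> 0 <= A -> 0 <= w -> (forall k, 0 <= a k) ->
  (forall k, c k <= c k.+1 <= c k + w) -> 0 <= c 0%N ->
  (exists N, X <= c N) -> (forall N, \sum_(k < N) a k <= S) ->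
  (forall x y, 0 <= x -> x <= y -> y <= X -> `|p y - p x| <= A * (y - x)) ->
  (forall k x y, c k <= x -> x <= y -> y <= X -> `|p y - p x| <= a k * (y - x)) ->
  `|p X - p 0| <= A * c 0%N + w * S.
Proof.
move=> X0 A0 w0 a0 cw c0 [N XN] aS near0 far.
suff claim y : 0 <= y -> y <= X -> y <= c N ->
    `|p y - p 0| <= A * c 0%N + w * \sum_(k < N) a k.
  apply: le_trans (claim X X0 (lexx X) XN) _.
  by rewrite lerD2l ler_wpM2l.
elim: N {XN} y => [|N IH] y y0 yX yc.
  rewrite big_ord0 mulr0 addr0; apply: le_trans (near0 0 y (lexx 0) y0 yX) _.
  by rewrite subr0 ler_wpM2l.
have cN0 : 0 <= c N.
  by elim: N {IH yc} => // N IH; apply: le_trans IH _; have /andP[] := cw N.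
rewrite big_ord_recr/= mulrDr addrA.
have aw0 : 0 <= w * a N by rewrite mulr_ge0.
have [yN|Ny] := leP y (c N); first by have := IH y y0 yX yN; lra.
have -> : p y - p 0 = (p y - p (c N)) + (p (c N) - p 0) by ring.
apply: le_trans (ler_normD _ _) _.
have h1 := IH (c N) cN0 (le_trans (ltW Ny) yX) (lexx _).
have h2 := far N (c N) y (lexx _) (ltW Ny) yX.
have h3 : a N * (y - c N) <= w * a N.
  by rewrite mulrC ler_wpM2r// lerBlDl (le_trans yc)//; have /andP[] := cw N.
lra.
Qed.
End Chain.

Section Geodesics.
Context {R : realType} {n : nat}.
Variables (Omega : set 'rV[R[i]]_n) (sigma : R -> 'rV[R[i]]_n) (L lambda kappa : R).
Hypothesis geo : almost_geodesic Omega lambda kappa `[0, L] sigma.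

(** Absolute continuity applied to a single interval. It makes the distance to the boundary
    continuous along the curve, so that its maximum is attained. *)
Lemma almost_geodesic_uniformly_continuous (e : R) : 0 < e ->
  exists2 d : R, 0 < d & forall s t, s \in `[0, L] -> t \in `[0, L] ->
    `|s - t| < d -> enorm (sigma s - sigma t) < e.
Proof.
move=> e0; have [_ _ /(_ e e0)[d d0 acd] _] := geo; exists d => //.
have W s t : s \in `[0, L] -> t \in `[0, L] -> s <= t -> `|s - t| < d ->
    enorm (sigma s - sigma t) < e.
  move=> sL tL st std; rewrite enormB.
  have := acd 1%N (fun=> s) (fun=> t); rewrite !big_ord1; apply.
  - move=> _; split => // x /=; move: sL tL; rewrite !in_itv/=.
    by move=> /andP[s0 _] /andP[_ tL] /andP[sx xt]; rewrite (le_trans s0)// (le_trans xt).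
  - by apply/trivIsetP => i j _ _; rewrite !ord1.
  - by rewrite -(ger0_norm (_ : 0 <= t - s)) ?subr_ge0// distrC.
move=> s t sL tL std; have [st|/ltW ts] := leP s t; first exact: W.
by rewrite enormB; apply: W => //; rewrite distrC.
Qed.

(** Here [h] stands for the real or imaginary part of a coordinate of [sigma]: the Lipschitz lemma
    concerns real functions, and the two hypotheses on [h] are all that is used of such a
    coordinate. *)
Lemma almost_geodesic_displacement (h : R -> R) (s t r m : R) :
  0 < lambda -> 0 <= m ->
  (forall a b, `|h b - h a| <= enorm (sigma b - sigma a)) ->
  (forall x, curve_derivable sigma x ->
     derivable h x 1 /\ `|derive1 h x| <= enorm (velocity sigma x)) ->
  0 <= s -> s <= t -> t <= L -> (kobayashi_M Omega r <= m%:E)%E ->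
  (forall x, s <= x <= t -> boundary_dist Omega (sigma x) <= r) ->
  `|h t - h s| <= lambda * m * (t - s).
Proof.
move=> l0 m0 hsigma hder s0 st tL Mm distr.
have [inO _ ac ae] := geo.
apply: absolutely_continuous_lipschitz => //.
- by rewrite mulr_ge0// ltW.
- move=> e e0; have [d d0 acd] := ac e e0; exists d => // k a b ab tI sd.
  apply: le_lt_trans (acd k a b _ tI sd); first by apply: ler_sum => i _; exact: hsigma.
  move=> i; have [sa aib bt] := ab i; split => // x; rewrite /= !in_itv/= => /andP[ax xb].
  by rewrite (le_trans s0)/= ?(le_trans sa)// (le_trans xb)// (le_trans bt).
- have [N [mN N0 hN]] := ae; exists N; split => //; apply: subset_trans hN.
  apply: subsetC => x /= hx /andP[sx xt].
  have xL : x \in `[0, L] by rewrite in_itv/= (le_trans s0 (ltW sx)) (le_trans (ltW xt)).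
  have [cd kv] := hx xL; have [dh hv] := hder x cd; split => //.
  apply: le_trans hv _.
  apply: (enorm_le_kobayashi_M (r := r) l0 m0 _ _ Mm kv); first exact: inO.
  by apply: distr; rewrite !ltW.
Qed.

End Geodesics.

Section Main.
Context {R : realType} {n : nat}.

Lemma Re_coordinate (sigma : R -> 'rV[R[i]]_n) j :
  (forall a b, `|complex.Re (sigma b ord0 j) - complex.Re (sigma a ord0 j)| <=
    enorm (sigma b - sigma a)) /\
  (forall x, curve_derivable sigma x ->
     derivable (fun t => complex.Re (sigma t ord0 j)) x 1 /\
     `|derive1 (fun t => complex.Re (sigma t ord0 j)) x| <= enorm (velocity sigma x)).
Proof.
split=> [a b|x /(_ j)[d _]].
  by have := Re_le_enorm (sigma b - sigma a) j; rewrite !mxE raddfB.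
by split => //; have := Re_le_enorm (velocity sigma x) j; rewrite mxE.
Qed.

Lemma Im_coordinate (sigma : R -> 'rV[R[i]]_n) j :
  (forall a b, `|complex.Im (sigma b ord0 j) - complex.Im (sigma a ord0 j)| <=
    enorm (sigma b - sigma a)) /\
  (forall x, curve_derivable sigma x ->
     derivable (fun t => complex.Im (sigma t ord0 j)) x 1 /\
     `|derive1 (fun t => complex.Im (sigma t ord0 j)) x| <= enorm (velocity sigma x)).
Proof.
split=> [a b|x /(_ j)[_ d]].
  by have := Im_le_enorm (sigma b - sigma a) j; rewrite !mxE raddfB.
by split => //; have := Im_le_enorm (velocity sigma x) j; rewrite mxE.
Qed.

Lemma enorm_gt0 (z : 'rV[R[i]]_n) : z != 0 -> 0 < enorm z.
Proof.
move=> z0; rewrite lt_neqAle enorm_ge0 andbT eq_sym.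
apply: contra z0 => /eqP z0; apply/eqP/rowP => j; rewrite mxE.
have := Re_le_enorm z j; have := Im_le_enorm z j; rewrite z0 !normr_le0.
by case: (z ord0 j) => x y /= /eqP-> /eqP->.
Qed.

(** Supplies the witness that makes [kobayashi_M] nonnegative at every positive radius. *)
Lemma exists_near_boundary (Omega : set 'rV[R[i]]_n) xi (r : R) :
  open Omega -> boundary Omega xi -> 0 < r ->
  exists2 z, Omega z & boundary_dist Omega z <= r.
Proof.
move=> oO [clxi nxi] r0; rewrite (interior_id Omega).1// in nxi.
have [z Oz xz] := (closure_enormP _ _).1 clxi r r0; exists z => //.
have coO : ~` Omega !=set0 by exists xi.
apply: le_trans (ltW xz); rewrite enormB; exact: boundary_dist_le.
Qed.

Lemma almost_geodesic_level (Omega : set 'rV[R[i]]_n) (sigma : R -> 'rV[R[i]]_n)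
    (L lambda kappa : R) (f : R -> R) z0 (t0 : R) :
  ~` Omega !=set0 -> open Omega -> 0 < lambda ->
  (forall s t, 0 < s -> s < t -> f s < f t) ->
  (forall z, Omega z ->
    (kobayashi_dist Omega z0 z <= (f (1 / boundary_dist Omega z))%:E)%E) ->
  almost_geodesic Omega lambda kappa `[0, L] sigma ->
  t0 \in `[0, L] ->
  (forall t, t \in `[0, L] ->
    boundary_dist Omega (sigma t) <= boundary_dist Omega (sigma t0)) ->
  forall (t rho y : R), t \in `[0, L] -> 0 < rho -> f (1 / rho) = y ->
    lambda * (2 * y + kappa) <= `|t - t0| ->
  boundary_dist Omega (sigma t) <= rho.
Proof.
move=> coO oO l0 f_incr fk geo t0L t0max t rho y tL rho0 fy tfar.
have [inO bounds _ _] := geo.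
have dpos s : s \in `[0, L] -> 0 < boundary_dist Omega (sigma s).
  by move=> sL; apply: boundary_dist_gt0 => //; exact: inO.
have fle : f (1 / boundary_dist Omega (sigma t0)) <=
    f (1 / boundary_dist Omega (sigma t)).
  rewrite incr_leE ?divr_gt0 ?dpos// !div1r lef_pV2 ?posrE ?dpos//; exact: t0max.
have /andP[lb _] := bounds t0 t t0L tL.
have := le_trans lb (kobayashi_dist_triangle Omega z0 (sigma t0) (sigma t)).
move=> /le_trans/(_ (leeD (fk _ (inO _ t0L)) (fk _ (inO _ tL)))).
rewrite -EFinD lee_fin => h.
have : y <= f (1 / boundary_dist Omega (sigma t)).
  have : 2 * y + kappa <= lambda^-1 * `|t - t0|.
    by rewrite ler_pdivlMl.
  lra.
by rewrite -fy incr_leE ?divr_gt0 ?dpos// !div1r lef_pV2 ?posrE ?dpos.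
Qed.

End Main.

(** * Displacement of an almost-geodesic that stays near the boundary *)

Section Displacement.
Context {R : realType} {n : nat}.

Lemma continuous_within_boundary_dist (Omega : set 'rV[R[i]]_n) sigma
    (L lambda kappa : R) :
  ~` Omega !=set0 -> almost_geodesic Omega lambda kappa `[0, L] sigma ->
  {within `[0, L], continuous (fun t => boundary_dist Omega (sigma t))}.
Proof.
move=> coO geo; apply/subspace_continuousP => x xL B /nbhs_ballP[e e0 eB].
have [d d0 hd] := almost_geodesic_uniformly_continuous geo e0.
apply/nbhs_ballP; exists d => // y xy yL; apply: eB.
by apply: le_lt_trans (boundary_dist_lipschitz _ _ _) _ => //; exact: hd.
Qed.

(** The factor 4 counts the near and the far part on each of the two sides of the maximum point
    [t0], at most [eta] each. *)
Lemma almost_geodesic_coordinate_small (Omega : set 'rV[R[i]]_n) sigma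
    (L lambda kappa : R) (f : R -> R) z0 (k0 : nat) (rho a : nat -> R)
    (h : R -> R) (r' m S eta : R) :
  ~` Omega !=set0 -> open Omega -> 1 <= lambda -> 0 <= kappa -> 0 <= L ->
  (forall s t, 0 < s -> s < t -> f s < f t) ->
  (forall z, Omega z ->
    (kobayashi_dist Omega z0 z <= (f (1 / boundary_dist Omega z))%:E)%E) ->
  almost_geodesic Omega lambda kappa `[0, L] sigma ->
  (forall k, [/\ 0 < rho k, f (1 / rho k) = (k0 + k)%:R, 0 <= a k &
    (kobayashi_M Omega (rho k) <= (a k)%:E)%E]) ->
  (forall N, \sum_(k < N) a k <= S) ->
  0 <= m -> (kobayashi_M Omega r' <= m%:E)%E ->
  (forall t, t \in `[0, L] -> boundary_dist Omega (sigma t) <= r') ->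
  (forall a b, `|h b - h a| <= enorm (sigma b - sigma a)) ->
  (forall x, curve_derivable sigma x ->
     derivable h x 1 /\ `|derive1 h x| <= enorm (velocity sigma x)) ->
  lambda * m * (lambda * (2 * k0%:R + kappa)) <= eta ->
  2 * lambda * (lambda * S) <= eta ->
  `|h L - h 0| <= 4 * eta.
Proof.
move=> coO oO l1 ka0 L0 f_incr fk geo lev aS m0 Mm near0 hs hd h1 h2.
have l0 : 0 < lambda by lra.
have [t0 t0L t0max] := EVT_max L0 (continuous_within_boundary_dist coO geo).
have /andP[t00 t0l] : 0 <= t0 <= L by move: t0L; rewrite in_itv.
have level := almost_geodesic_level coO oO l0 f_incr fk geo t0L t0max.
(* The time away from [t0] after which the curve is within [rho k] of the boundary; consecutive
   values differ by [2 * lambda]. *)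
pose c k := lambda * (2 * (k0 + k)%:R + kappa).
have ck0 k : 0 <= c k by rewrite /c mulr_ge0 ?addr_ge0 ?mulr_ge0// ltW.
have c0 := ck0 0%N.
have cw k : c k <= c k.+1 <= c k + 2 * lambda.
  have -> : c k.+1 = c k + 2 * lambda by rewrite /c addnS -natr1; ring.
  by rewrite lexx lerDl mulr_ge0// ltW.
have cX X : exists N, X <= c N.
  exists (Num.bound `|X|); apply: le_trans (ler_norm _) _.
  apply: le_trans (ltW (archi_boundP (normr_ge0 X))) _.
  set N := (Num.bound _)%:R; rewrite /c natrD -/N.
  have N0 : 0 <= N by []. have k00 : 0 <= k0%:R :> R by [].
  have : N <= lambda * N by rewrite ler_peMl.
  have : 0 <= lambda * (2 * k0%:R + N + kappa).
    by rewrite mulr_ge0 ?addr_ge0 ?mulr_ge0// ltW.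
  lra.
have la k : 0 <= lambda * a k by rewrite mulr_ge0 ?(ltW l0)//; have [] := lev k.
have laS N : \sum_(k < N) lambda * a k <= lambda * S.
  by rewrite -mulr_sumr ler_wpM2l// ltW.
have lm : 0 <= lambda * m by rewrite mulr_ge0// ltW.
have disp s t rr mm : 0 <= mm -> 0 <= s -> s <= t -> t <= L ->
    (kobayashi_M Omega rr <= mm%:E)%E ->
    (forall x, s <= x <= t -> boundary_dist Omega (sigma x) <= rr) ->
    `|h t - h s| <= lambda * mm * (t - s).
  by move=> mm0 s0 st tl; exact: (almost_geodesic_displacement geo l0 mm0 hs hd).
have c0E : c 0%N = lambda * (2 * k0%:R + kappa) by rewrite /c addn0.
have right : `|h L - h t0| <= 2 * eta.
  have := @chain_displacement R (fun x => h (t0 + x)) (L - t0) (lambda * m)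
    (2 * lambda) (lambda * S) c (fun k => lambda * a k).
  rewrite addr0 subrKC c0E => chain; apply: le_trans (chain _ _ _ la cw _ _ laS _ _) _ => //.
  - by rewrite subr_ge0.
  - by rewrite mulr_ge0// ltW.
  - by rewrite -c0E.
  - move=> x y x0 xy yX.
    have -> : y - x = (t0 + y) - (t0 + x) by ring.
    apply: disp Mm _ => //; [lra|lra|lra|].
    by move=> z /andP[zx zy]; apply: near0; rewrite in_itv/=; apply/andP; split; lra.
  - move=> k x y cx xy yX; have [rk fr ak Mk] := lev k.
    have x0 : 0 <= x by exact: le_trans cx.
    have -> : y - x = (t0 + y) - (t0 + x) by ring.
    apply: disp Mk _ => //; [lra|lra|lra|].
    move=> z /andP[zx zy]; apply: (level z _ _ _ rk fr).
      by rewrite in_itv/=; apply/andP; split; lra.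
    by rewrite ger0_norm; [rewrite -/(c k); lra|lra].
  - lra.
(* The same estimate with time running backwards from [t0]. *)
have left : `|h t0 - h 0| <= 2 * eta.
  have := @chain_displacement R (fun x => h (t0 - x)) t0 (lambda * m)
    (2 * lambda) (lambda * S) c (fun k => lambda * a k).
  rewrite subr0 subrr c0E distrC => chain; apply: le_trans (chain _ _ _ la cw _ _ laS _ _) _ => //.
  - by rewrite mulr_ge0// ltW.
  - by rewrite -c0E.
  - move=> x y x0 xy yX; rewrite distrC.
    have -> : y - x = (t0 - x) - (t0 - y) by ring.
    apply: disp Mm _ => //; [lra|lra|lra|].
    by move=> z /andP[zx zy]; apply: near0; rewrite in_itv/=; apply/andP; split; lra.
  - move=> k x y cx xy yX; have [rk fr ak Mk] := lev k.
    have x0 : 0 <= x by exact: le_trans cx.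
    rewrite distrC.
    have -> : y - x = (t0 - x) - (t0 - y) by ring.
    apply: disp Mk _ => //; [lra|lra|lra|].
    move=> z /andP[zx zy]; apply: (level z _ _ _ rk fr).
      by rewrite in_itv/=; apply/andP; split; lra.
    by rewrite ler0_norm; [rewrite -/(c k); lra|lra].
  - lra.
have -> : h L - h 0 = (h L - h t0) + (h t0 - h 0) by ring.
apply: le_trans (ler_normD _ _) _; lra.
Qed.
End Displacement.

Theorem theorem1p5 (R : realType) (n : nat) (Omega : set 'rV[R[i]]_n)
  (HOmega : bounded_domain Omega)
  (HM : kobayashi_M Omega t @[t --> 0^'+] --> 0%E)
  (Hf : exists f : R -> R,
    [/\ forall t, 0 < t -> derivable f t 1 /\ {for t, continuous (derive1 f)},
        forall s t, 0 < s -> s < t -> f s < f t,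
        f t @[t --> +oo] --> +oo,
        exists2 z0, Omega z0 & forall z, Omega z ->
          (kobayashi_dist Omega z0 z <= (f (1 / boundary_dist Omega z))%:E)%E
      & exists2 r0 : R, 0 < r0 &
          (\int[lebesgue_measure]_(r in `]0%R, r0[)
             (kobayashi_M Omega r * (r ^- 2 * derive1 f (1 / r))%:E)
           < +oo)%E]) :
  visibility_domain Omega.
Proof.
have [bO oO _ _] := HOmega; split => // lambda kappa l1 ka0 xi eta bxi beta xieta.
move=> V W [Vxi [U oU VU]] [Weta [U' oU' WU]] VW.
(* In dimension 0 there is a single point, so [xi] and [eta] could not be distinct. *)
have n0 : (0 < n)%N.
  by case: n xi eta xieta {Omega HOmega HM Hf bO oO bxi beta V W Vxi U oU VU Weta U' oU' WU VW}
    => // xi eta /negP[]; apply/eqP/rowP => -[].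
have coO := bounded_setC_neq0 n0 bO.
have [e e0 sep] : exists2 e : R, 0 < e & forall v w, V v -> W w -> e <= enorm (v - w).
  apply: (separated_closures bO _ _ VW); last by exists eta.
  by rewrite VU; exact: subIsetr.
have [f [df f_incr foo [z0 Oz0 fk] [r0 r00 intM]]] := Hf.
have u0 : 0 < enorm (xi - eta) by rewrite enorm_gt0// subr_eq0.
(* Any unit vector would do; the distinct points [xi] and [eta] provide one. *)
pose v1 := ((enorm (xi - eta))^-1)%:C *: (xi - eta).
have v11 : enorm v1 = 1 by rewrite enormZ gtr0_norm ?invr_gt0// mulVf// gt_eqF.
have M0 r : 0 < r -> (0 <= kobayashi_M Omega r)%E.
  move=> rp; have [z Oz zr] := exists_near_boundary oO bxi rp.
  exact: kobayashi_M_ge0 Oz zr v11.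
have [k0 [rho [I [hrho sumI]]]] :=
  exists_summable_levels df f_incr foo r00 M0 (@kobayashi_M_le _ _ Omega) HM intM.
have l0 : 0 < lambda by lra.
(* Each of the [2 n] real coordinates will move by at most [4 et], in total [8 n et], which is
   strictly less than [e]. *)
pose et := e / (8 * n.+1%:R).
have n10 : 0 < 8 * n.+1%:R :> R by rewrite mulr_gt0.
have et0 : 0 < et by rewrite divr_gt0.
have a0 k : 0 <= fine (kobayashi_M Omega (rho k)).
  by rewrite fine_ge0// M0//; have [] := hrho k.
have S0 : 0 < et / (2 * lambda * lambda) by rewrite divr_gt0// !mulr_gt0.
(* The first [K] levels are handed over to the near part; the remaining sum is small enough that its
   contribution, [2 * lambda * lambda] times it, is at most [et]. *)
have [K hK] := bounded_series_tail a0 sumI S0.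
pose c0 := lambda * (2 * (k0 + K)%:R + kappa).
have c00 : 0 <= c0 by rewrite mulr_ge0 ?addr_ge0 ?mulr_ge0// ltW.
(* Chosen so that time [c0] at speed [lambda * m] costs at most [et]; the added 1 allows for
   [c0 = 0]. *)
pose m := et / (lambda * (c0 + 1)).
have lc : 0 < lambda * (c0 + 1) by rewrite mulr_gt0// ltr_wpDl.
have m0 : 0 < m by rewrite divr_gt0.
(* The radius depends on [m], hence on [K], and not on any curve: this is the uniformity that
   visibility demands. *)
have [r' r'0 Mr'] : exists2 r', 0 < r' & (kobayashi_M Omega r' <= m%:E)%E.
  have : nbhs (0%E : \bar R) [set x | (x < m%:E)%E].
    by apply: open_nbhs_nbhs; split; [exact: open_ereal_lt_ereal|rewrite /= lte_fin].
  move=> /HM h1.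
  have /nbhs_ballP[d /= d0 hd] :
    nbhs (0 : R) (fun t => 0 < t -> (kobayashi_M Omega t < m%:E)%E) := h1.
  exists (d / 2); first by rewrite divr_gt0.
  apply/ltW/hd; last by rewrite divr_gt0.
  by rewrite /ball/= sub0r normrN gtr0_norm ?divr_gt0//; lra.
have [cK KO] := compact_boundary_dist_ge coO r'0 bO.
exists [set z | r' <= boundary_dist Omega z]; split => //.
move=> L sigma L0 geo V0 WL; apply: contrapT => meet.
have near0 t : t \in `[0, L] -> boundary_dist Omega (sigma t) <= r'.
  move=> tL; rewrite leNgt; apply/negP => rt; apply: meet; exists (sigma t).
  by split; [exists t|exact: ltW].
have lev k : [/\ 0 < rho (K + k)%N, f (1 / rho (K + k)%N) = (k0 + K + k)%:R,
    0 <= fine (kobayashi_M Omega (rho (K + k)%N)) &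
    (kobayashi_M Omega (rho (K + k)%N) <= (fine (kobayashi_M Omega (rho (K + k)%N)))%:E)%E].
  by have [p1 p2 p3] := hrho (K + k)%N; split; rewrite ?addnA ?fineK// -addnA.
have small (h : R -> R) : (forall a b, `|h b - h a| <= enorm (sigma b - sigma a)) ->
    (forall x, curve_derivable sigma x ->
     derivable h x 1 /\ `|derive1 h x| <= enorm (velocity sigma x)) ->
    `|h L - h 0| <= 4 * et.
  move=> hs hd.
  apply: (almost_geodesic_coordinate_small (eta := et) (rho := fun k => rho (K + k)%N)
    (a := fun k => fine (kobayashi_M Omega (rho (K + k)%N))) coO oO l1 ka0 L0 f_incr fk geo lev hK
    (ltW m0) Mr' near0 hs hd).
    rewrite -/c0 /m; have -> : lambda * (et / (lambda * (c0 + 1))) * c0 = et * (c0 / (c0 + 1)).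
      by field; rewrite !gt_eqF// ltr_wpDl.
    by rewrite ger_pMr// ler_pdivrMr ?mul1r ?lerDl// ltr_wpDl.
  by rewrite le_eqVlt; apply/orP; left; apply/eqP; field; rewrite gt_eqF.
have := sep _ _ V0 WL; rewrite enormB; apply/negP; rewrite -ltNge.
apply: le_lt_trans (enorm_le_sum _) _.
apply: (@le_lt_trans _ _ (\sum_(j < n) (8 * et))).
  apply: ler_sum => j _.
  have [s1 d1] := Re_coordinate sigma j; have [s2 d2] := Im_coordinate sigma j.
  have := small _ s1 d1; have := small _ s2 d2; rewrite !mxE !raddfB /=; lra.
rewrite sumr_const card_ord -[X in X < _]mulr_natr /et.
have -> : 8 * (e / (8 * n.+1%:R)) * n%:R = e * (n%:R / n.+1%:R) :> R.
  by field; rewrite gt_eqF.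
by rewrite gtr_pMr// ltr_pdivrMr// mul1r ltr_nat.
Qed.
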